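(* For $(i,r)\in V$ and $w\in W$ such that $ws_i>w$, we have $$\underline Q_{ws_i(\varpi_i),\,q^{r}}\,\underline Q_{w(\varpi_i),\,q^{r-2}}-\underline Q_{ws_i(\varpi_i),\,q^{r-2}}\,\underline Q_{w(\varpi_i),\,q^{r}}=\prod_{j:\ c_{ij}=-1}\underline Q_{w(\varpi_j),\,q^{r-1}}.$$
   Context: **Lie data.** $\mathfrak g$ is a simple complex Lie algebra of type $A,D,E$; $I$ is the vertex set of its Dynkin diagram, $(c_{ij})$ its symmetric Cartan matrix, $h_i$ the simple coroots, $\varpi_i$ the fundamental weights, $\alpha_i=\sum_jc_{ji}\varpi_j$ the simple roots, $P=\bigoplus_i\mathbb Z\varpi_i$, $Q_+=\bigoplus_i\mathbb Z_{\ge0}\alpha_i$, $W$ the Weyl group with simple reflections $s_i$ and length $\ell$; $ws_i>w$ means $\ell(ws_i)=\ell(w)+1$. $V\subset I\times\mathbb Z$ is the vertex set of one (fixed) of the two connected components of the quiver on $I\times\mathbb Z$ with arrows $(i,r)\to(j,s)$ iff $c_{ij}\ne0$ and $s=r+c_{ij}$. **Power series rings.** Fix $q\in\mathbb C^*$ not a root of unity. Let $\mathcal Y'=\mathbb Z[\Psi_{i,a}^{\pm1},[\lambda];\,i\in I,a\in\mathbb C^*,\lambda\in P]$, with independent commuting variables $\Psi_{i,a}$ and $[\lambda][\mu]=[\lambda+\mu]$. Put $Y_{i,a}=[\varpi_i]\Psi_{i,aq^{-1}}\Psi_{i,aq}^{-1}$, $A_{i,a}=Y_{i,aq^{-1}}Y_{i,aq}\prod_{j:c_{ij}=-1}Y_{j,a}^{-1}$,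 $\widetilde\Psi_{i,a}=\Psi_{i,a}^{-1}\prod_{j:c_{ij}=-1}\Psi_{j,aq}$. For a Laurent monomial $m$ let $\omega'(m)\in P$ be multiplicative with $\omega'(\Psi_{i,a})=0$, $\omega'([\lambda])=\lambda$. For $w\in W$, $\widetilde{\mathcal Y}'_w$ is the ring of formal sums $\sum_{m\in S}a_mm$ ($a_m\in\mathbb Z$) such that $w(\omega'(S))$ lies in a finite union of cones $\lambda-Q_+$ and, for each $\lambda$, finitely many $m$ with $a_m\ne0$ have $\omega'(m)=\lambda$. $\Pi'=\bigoplus_{w\in W}\widetilde{\mathcal Y}'_w$ (componentwise operations); $E'_e$ is the projection to the component $w=e$. Continuity below refers to the convergence (componentwise in $\Pi'$): in the component $\widetilde{\mathcal Y}'_w$, supports $S$ with $w(\omega'(S))$ contained in one common finite union of cones $\lambda-Q_+$, and eventual equality of each weight part. Let $\Sigma^+_{i,a}=\sum_{k\ge0}\prod_{0<j\le k}A^{-1}_{i,aq^{-2(j-1)}}$, $\Sigma^-_{i,a}=-\sum_{k>0}\prod_{0<j\le k}A_{i,aq^{2j}}$, and $\Sigma^w_{i,a}=\Sigma^{\pm}_{i,a}$ according as $\pm w(\alpha_i)>0$. $\widetilde\Theta_i$ is the continuous ring endomorphism of $\Pi'$ with components $\widetilde{\mathcal Y}'_w\to\widetilde{\mathcal Y}'_{ws_i}$, $[\lambda]\mapsto[s_i(\lambda)]$, $\Psi_{j,a}\mapsto\Psi_{j,a}$ ($j\ne i$), $\Psi_{i,a}\mapsto(1-[-\alpha_i])\widetilde\Psi_{i,aq^{-2}}\Sigma^{ws_i}_{i,aq^{-2}}$.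 These define an action $w\mapsto\widetilde\Theta_w$ of $W$. Let $\chi_{w(\varpi_i)}\in\Pi'$ be the unique family with $\chi_{\varpi_i}=1$ and $\chi_{ws_i(\varpi_i)}\chi_{w(\varpi_i)}=(1-[-w(\alpha_i)])^{-1}\prod_{j\ne i}\chi_{w(\varpi_j)}^{|c_{ij}|}$ whenever $ws_i>w$. Put $Q_{w(\varpi_i),a}=E'_e(\chi_{w(\varpi_i)}\widetilde\Theta_w(\Psi_{i,a}))\in K:=\widetilde{\mathcal Y}'_e$, which depends only on $w(\varpi_i)$ and $a$; it factors uniquely as $\Psi_{w(\varpi_i),a}\Sigma_{w(\varpi_i),a}$ with $\Psi_{w(\varpi_i),a}$ a Laurent monomial in the $\Psi_{j,b}$ and $\Sigma_{w(\varpi_i),a}$ a power series in the $A_{j,b}^{-1}$ with constant term $1$. Let $\underline P=\frac12\mathbb Z\otimes P$, and let $\Omega$ be the homomorphism from Laurent monomials in $\Psi_{i,q^r}$ ($(i,r)\in V$), $[\lambda]$ to $\underline P$ with $\Omega(\Psi_{i,q^r})=\frac r2\varpi_i$, $\Omega([\lambda])=\lambda$. For $(i,r)\in V$ put $\underline Q_{w(\varpi_i),q^r}=[-\Omega(\Psi_{w(\varpi_i),q^r})]\,Q_{w(\varpi_i),q^r}\in\mathbb Z[\underline P]\otimes_{\mathbb Z[P]}K$. *)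

(* Defs.v *)
From Stdlib Require Import Relation_Operators.
From HB Require Import structures.
From mathcomp Require Import all_boot all_order all_algebra.
From mathcomp Require Import boolp classical_sets functions cardinality fsbigop.
From mathcomp Require Import reals complex freeg zify ring.

Set Implicit Arguments.
Unset Strict Implicit.
Unset Printing Implicit Defensive.

Import Order.TTheory GRing.Theory Num.Theory.
Local Open Scope classical_set_scope.
Local Open Scope ring_scope.

(* Formal sums, possibly infinite, of elements of an abelian group [gmon] of
   monomials, written additively. Supports are controlled by a weight
   [wt] in a lattice [glat]: the weights, moved by [twist], must lie in a
   finite union of cones l - [cone], and each weight occurs finitely often. *)
Record grading := Grading {
  gmon : zmodType;
  glat : zmodType;
  wt : {additive gmon -> glat};
  twist : {additive glat -> glat};
  cone : set glat;
  twist_inj : injective twist;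
  cone0 : cone 0;
  coneD : forall x y, cone x -> cone y -> cone (x + y);
  cone_fin : forall v, finite_set [set x | cone x /\ cone (v - x)] }.

Arguments wt : clear implicits.
Arguments twist : clear implicits.
Arguments cone : clear implicits.

Section Support.
Variable G : grading.
Implicit Types (S T : set (gmon G)) (s : seq (glat G)).

Definition bounded_by s S :=
  forall m, S m -> exists2 l, l \in s & cone G (l - twist G (wt G m)).

Definition admissible S :=
  (exists s, bounded_by s S) /\
  forall l : glat G, finite_set [set m | S m /\ wt G m = l].

Lemma admissibleS S T : S `<=` T -> admissible T -> admissible S.
Proof.
move=> ST [[s sT] fT]; split; first by exists s => m /ST; apply: sT.
by move=> l; apply: sub_finite_set (fT l) => m /= [/ST].
Qed.

Lemma admissible0 : admissible set0.
Proof.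
split; first by exists [::].
by move=> l; apply: sub_finite_set (finite_set0 _) => m /= [].
Qed.

Lemma admissible1 m : admissible [set m].
Proof.
split; first exists [:: twist G (wt G m)].
  by move=> _ ->; exists (twist G (wt G m)); rewrite ?inE// subrr; apply: cone0.
by move=> l; apply: sub_finite_set (finite_set1 m) => x /= [].
Qed.

Lemma admissibleU S T : admissible S -> admissible T -> admissible (S `|` T).
Proof.
move=> [[s sS] fS] [[t tT] fT]; split.
  exists (s ++ t) => m [/sS|/tT] [l ls cl]; exists l => //;
  by rewrite mem_cat ls ?orbT.
move=> l; apply: sub_finite_set (_ : finite_set
  ([set m | S m /\ wt G m = l] `|` [set m | T m /\ wt G m = l])).
  by move=> m /= [[?|?] ?]; [left|right].
by rewrite finite_setU; split; [apply: fS|apply: fT].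
Qed.

Definition addset S T : set (gmon G) :=
  [set m | exists x y, [/\ S x, T y & m = x + y]].

Lemma addset_weights S T l : admissible S -> admissible T ->
  finite_set [set k | exists x y,
    [/\ S x, T y, wt G (x + y) = l & wt G x = k]].
Proof.
move=> [[s sS] fS] [[t tT] fT].
pose F : set (glat G) := \bigcup_(p in [set` s] `*` [set` t])
  [set k | cone G (p.1 - twist G k) /\
           cone G ((p.1 + p.2 - twist G l) - (p.1 - twist G k))].
apply: (@sub_finite_set _ _ F) => [k [x [y [Sx Ty xyl <-]]]|].
  have [a ain ca] := sS _ Sx; have [b bin cb] := tT _ Ty.
  exists (a, b) => //=; split=> //.
  suff -> : a + b - twist G l - (a - twist G (wt G x)) = b - twist G (wt G y).
    by [].
  have -> : twist G l = twist G (wt G x) + twist G (wt G y).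
    by rewrite -xyl !raddfD.
  by rewrite [- (twist G _ + _)]opprD [a + b + _]addrACA [LHS]addrC addKr.
apply: bigcup_finite; first by apply: finite_setX; apply: finite_seq.
move=> [a b] _ /=.
pose C := [set x | cone G x /\ cone G ((a + b - twist G l) - x)].
apply: (@sub_finite_set _ _ ((fun k => a - twist G k) @^-1` C)).
  by move=> k /=.
apply: finite_preimage; last exact: cone_fin.
by move=> x y _ _ /addrI /oppr_inj /twist_inj.
Qed.

Lemma addset_fiber S T l : admissible S -> admissible T ->
  finite_set [set p : gmon G * gmon G |
              [/\ S p.1, T p.2 & wt G (p.1 + p.2) = l]].
Proof.
move=> aS aT; have fK := addset_weights l aS aT.
set K := (X in finite_set X) in fK.
have [[_ fS] [_ fT]] := (aS, aT).
apply: (@sub_finite_set _ _ (\bigcup_(k in K)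
  ([set m | S m /\ wt G m = k] `*` [set m | T m /\ wt G m = l - k]))).
  move=> [x y] /= [Sx Ty xyl]; exists (wt G x); first by exists x, y.
  by split=> //=; split=> //; rewrite -xyl raddfD /= addrAC subrr add0r.
by apply: bigcup_finite => // k _; apply: finite_setX.
Qed.

Lemma admissibleD S T : admissible S -> admissible T ->
  admissible (addset S T).
Proof.
move=> aS aT; split; last first.
  move=> l; have := addset_fiber l aS aT.
  move=> /(finite_image (fun p => p.1 + p.2)); apply: sub_finite_set.
  by move=> _ [[x [y [Sx Ty ->]]] xyl]; exists (x, y).
have [[[s sS] _] [[t tT] _]] := (aS, aT).
exists [seq x + y | x <- s, y <- t] => _ [x [y [Sx Ty ->]]].
have [a ain ca] := sS _ Sx; have [b bin cb] := tT _ Ty.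
exists (a + b); first by apply/allpairsP; exists (a, b).
have -> : twist G (wt G (x + y)) = twist G (wt G x) + twist G (wt G y).
  by rewrite !raddfD.
by rewrite opprD addrACA; apply: coneD.
Qed.

End Support.

Section Fps.
Variable G : grading.
Local Notation M := (gmon G).

Definition fsupp (f : M -> int) : set M := [set m | f m != 0].

(* [f m] is the coefficient of the monomial [m] in the formal sum [f]. *)
Record fps := Fps { fcoef :> M -> int; fcoefP : admissible (fsupp fcoef) }.

Lemma fpsP (f g : fps) : fcoef f =1 fcoef g -> f = g.
Proof.
case: f g => [f fP] [g gP] /= /funext fg; subst g; congr Fps.
exact: Prop_irrelevance.
Qed.

HB.instance Definition _ := gen_eqMixin fps.
HB.instance Definition _ := gen_choiceMixin fps.

Implicit Types f g h : fps.

Fact fsupp0 : admissible (fsupp (fun=> 0)).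
Proof. by apply: admissibleS (@admissible0 G) => m /=; rewrite ?eqxx. Qed.
Definition fzero : fps := Fps fsupp0.

Fact fsuppN f : admissible (fsupp (fun m => - f m)).
Proof. by apply: admissibleS (fcoefP f) => m; rewrite /fsupp /= oppr_eq0. Qed.
Definition fopp f : fps := Fps (fsuppN f).

Fact fsuppD f g : admissible (fsupp (fun m => f m + g m)).
Proof.
apply: admissibleS (admissibleU (fcoefP f) (fcoefP g)) => m.
rewrite /fsupp /=; have [->|] := eqVneq (f m) 0; last by left.
by rewrite add0r; right.
Qed.
Definition fadd f g : fps := Fps (fsuppD f g).

Fact fsuppX (m0 : M) : admissible (fsupp (fun m => (m == m0)%:R)).
Proof.
apply: admissibleS (admissible1 m0) => m; rewrite /fsupp /=.
by case: (m =P m0).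
Qed.
Definition fmon m0 : fps := Fps (fsuppX m0).

Definition conv (f g : M -> int) (m : M) : int :=
  \sum_(x \in [set: M]) f x * g (m - x).

Lemma convE f g m (A : set M) :
  (forall x, f x != 0 -> g (m - x) != 0 -> A x) ->
  conv f g m = \sum_(x \in A) f x * g (m - x).
Proof.
move=> fgA; apply/esym; apply: fsbig_widen => // x [_ nAx].
apply/eqP; rewrite mulf_eq0; apply/norP => -[fx gx]; exact/nAx/fgA.
Qed.

Definition conv_dom f g (m : M) : set M := [set x | f x != 0 /\ g (m - x) != 0].

Lemma conv_dom_fin f g m : finite_set (conv_dom f g m).
Proof.
have := addset_fiber (wt G m) (fcoefP f) (fcoefP g).
move=> /(finite_image fst); apply: sub_finite_set => x /= [fx gx].
by exists (x, m - x) => //=; split=> //; rewrite addrC subrK.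
Qed.

Fact fsuppM f g : admissible (fsupp (conv f g)).
Proof.
apply: admissibleS (admissibleD (fcoefP f) (fcoefP g)) => m.
rewrite /fsupp /= => cm.
have [x _] := @fsbigN1 _ _ _ _ _ _ (fun m x => f x * g (m - x)) m cm; rewrite mulf_eq0 => /norP [fx gx].
by exists x, (m - x); split; rewrite // addrC subrK.
Qed.
Definition fmul f g : fps := Fps (fsuppM f g).

Fact faddA : associative fadd.
Proof. by move=> f g h; apply: fpsP => m /=; rewrite addrA. Qed.
Fact faddC : commutative fadd.
Proof. by move=> f g; apply: fpsP => m /=; rewrite addrC. Qed.
Fact fadd0 : left_id fzero fadd.
Proof. by move=> f; apply: fpsP => m /=; rewrite add0r. Qed.
Fact faddN : left_inverse fzero fopp fadd.
Proof. by move=> f; apply: fpsP => m /=; rewrite addNr. Qed.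

HB.instance Definition _ := GRing.isZmodule.Build fps faddA faddC fadd0 faddN.

Fact fmulC : commutative fmul.
Proof.
move=> f g; apply: fpsP => m /=; rewrite /conv.
rewrite (@reindex_fsbigT _ _ _ _ _ (fun x => m - x)) /=.
  by apply: eq_fsbigr => x _; rewrite subKr mulrC.
by exists (fun x => m - x) => x; rewrite subKr.
Qed.

Fact fmulCA f g h : fmul f (fmul g h) = fmul g (fmul f h).
Proof.
apply: fpsP => m /=.
pose A u v : set M := conv_dom u (fmul v h) m `|`
  [set x | exists y z, [/\ u x != 0, v y != 0, h z != 0 & x + (y + z) = m]].
have afin (u v : fps) : finite_set (A u v).
  rewrite finite_setU; split; first exact: conv_dom_fin.
  have := addset_fiber (wt G m) (fcoefP u) (admissibleD (fcoefP v) (fcoefP h)).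
  move=> /(finite_image fst); apply: sub_finite_set.
  move=> x [y [z [ux vy hz xyz]]]; exists (x, y + z) => //=; split=> //.
    by exists y, z.
  by rewrite xyz.
have E (u v : fps) : conv u (conv v h) m =
    \sum_(x \in A u v) \sum_(y \in A v u) u x * (v y * h (m - x - y)).
  rewrite (@convE u (fmul v h) m (A u v)); last by move=> x ux vx; left.
  apply: eq_fsbigr => x _; rewrite -mulr_fsumr /=.
  have [->|ux] := eqVneq (u x) 0; first by rewrite !mul0r.
  congr (_ * _); apply: convE => y vy hy; right; exists x, (m - x - y).
  by split=> //; rewrite addrAC [x + _]addrC subrK [LHS]addrC subrK.
rewrite !E exchange_fsbig //; apply: eq_fsbigr => x _; apply: eq_fsbigr => y _.
by rewrite mulrCA addrAC.
Qed.

Fact fmulA : associative fmul.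
Proof.
by move=> f g h; rewrite [fmul g h]fmulC fmulCA fmulC; congr fmul.
Qed.

Fact fmul1 : left_id (fmon 0) fmul.
Proof.
move=> f; apply: fpsP => m /=.
rewrite (@convE (fmon 0) f m [set 0]); last first.
  by move=> x /=; case: (x =P 0).
by rewrite fsbig_set1 /= eqxx mul1r subr0.
Qed.

Fact fmulDl : left_distributive fmul fadd.
Proof.
move=> f g h; apply: fpsP => m /=.
pose A := conv_dom f h m `|` conv_dom g h m.
have fA : finite_set A by rewrite finite_setU; split; apply: conv_dom_fin.
rewrite (@convE (fadd f g) h m A) => [|x /= fgx hx]; last first.
  have [fx|fx] := eqVneq (f x) 0; last by left.
  by right; split=> //; rewrite fx add0r in fgx.
rewrite (@convE f h m A) => [|x fx hx]; last by left.
rewrite (@convE g h m A) => [|x gx hx]; last by right.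
by rewrite -fsbig_split //; apply: eq_fsbigr => x _; rewrite /= mulrDl.
Qed.

Fact fone_neq0 : fmon 0 != fzero.
Proof. by apply/eqP => /(congr1 (fun f : fps => f 0)) /=; rewrite eqxx. Qed.

HB.instance Definition _ := GRing.Zmodule_isComNzRing.Build fps
  fmulA fmulC fmul1 fmulDl fone_neq0.

End Fps.

(* [DynA n] is the type A_(n+1) and [DynD n] is the type D_(n+4). *)
Inductive dynkin := DynA of nat | DynD of nat | DynE6 | DynE7 | DynE8.

Definition rank (t : dynkin) : nat :=
  match t with
  | DynA n => n.+1 | DynD n => n.+4 | DynE6 => 6 | DynE7 => 7 | DynE8 => 8
  end.

(* The path 0 - 1 - ... - (n-2) with the extra vertex n-1 attached to b;
   with b = n-3 this is D_n, and with b = 2 it is E_n. *)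
Definition branch_edge (n b i j : nat) : bool :=
  (j == i.+1) && (j < n.-1)%N || (i == b) && (j == n.-1).

Definition edge (t : dynkin) (i j : nat) : bool :=
  match t with
  | DynA _ => j == i.+1
  | DynD n => branch_edge n.+4 n.+1 i j
  | _ => branch_edge (rank t) 2 i j
  end.

Definition adjacent t i j := edge t i j || edge t j i.

Definition cartan t : 'M[int]_(rank t) :=
  \matrix_(i, j) if i == j then 2 else if adjacent t i j then -1 else 0.

Notation vertex t := 'I_(rank t).
(* The weight lattice, in the coordinates given by the fundamental weights:
   [x i 0] is the pairing of [x] with the simple coroot h_i. *)
Notation wlattice t := 'cV[int]_(rank t).

Definition varpi t (i : vertex t) : wlattice t := delta_mx i 0.

Definition alpha t (i : vertex t) : wlattice t :=
  \sum_j cartan t j i *: varpi j.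

Definition Qplus t : set (wlattice t) :=
  [set b | exists a : {ffun vertex t -> nat}, b = \sum_i alpha i *+ a i].

Arguments Qplus : clear implicits.

Lemma Qplus0 t : Qplus t 0.
Proof.
exists [ffun=> 0%N]; rewrite big1 // => i _; by rewrite ffunE mulr0n.
Qed.

Lemma QplusD t x y : Qplus t x -> Qplus t y -> Qplus t (x + y).
Proof.
move=> [a ->] [b ->]; exists [ffun i => (a i + b i)%N].
by rewrite -big_split; apply: eq_bigr => i _; rewrite ffunE mulrnDr.
Qed.

(* Positive multiples of the coefficients of the sum of the positive coroots;
   they only serve to prove [Qplus_fin]. *)
Definition height_coef t (i : nat) : nat :=
  match t with
  | DynA n => i.+1 * (n.+1 - i)
  | DynD n => if (i < n.+2)%N then (i.+1 * (n.+4.*2 - i.+2)).*2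
              else n.+4 * n.+3
  | DynE6 => nth 0 [:: 16; 30; 42; 30; 16; 22] i
  | DynE7 => nth 0 [:: 34; 66; 96; 75; 52; 27; 49] i
  | DynE8 => nth 0 [:: 92; 182; 270; 220; 168; 114; 58; 136] i
  end%N.

Lemma adjacent_sum (n : nat) (P : pred nat) (d : nat -> nat) (s : seq nat) :
  (forall j, (j < n)%N -> P j -> j \in s) ->
  (\sum_(j < n | P j) d j <= \sum_(x <- s) d x)%N.
Proof.
move=> Ps; apply: (@leq_trans (\sum_(j < n) \sum_(x <- s) (x == j) * d x)%N).
  rewrite big_mkcond; apply: leq_sum => j _; case: ifP => // Pj.
  have js := Ps _ (ltn_ord j) Pj; rewrite (big_rem _ js) /= eqxx mul1n.
  exact: leq_addr.
rewrite exchange_big; apply: leq_sum => x _; rewrite -big_distrl /=.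
rewrite -[leqRHS]mul1n leq_mul2r; apply/orP; right.
have [xn|xn] := ltnP x n.
  rewrite (bigD1 (Ordinal xn)) //= eqxx big1 // => j.
  by apply: contraNeq; rewrite eqb0 negbK -val_eqE /= eq_sym.
rewrite big1 // => j _; apply/eqP; rewrite eqb0.
by apply: contraTneq xn => ->; rewrite -ltnNge.
Qed.

Lemma height_gt_aux t (i : nat) (s : seq nat) :
  (forall j, (j < rank t)%N -> adjacent t j i -> j \in s) ->
  (\sum_(x <- s) height_coef t x < (height_coef t i).*2)%N ->
  (\sum_(j < rank t | adjacent t j i) height_coef t j <
   (height_coef t i).*2)%N.
Proof.
by move=> adjs; apply: leq_ltn_trans; apply: (adjacent_sum _ adjs).
Qed.

Lemma height_gt t (i : nat) : (i < rank t)%N ->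
  (\sum_(j < rank t | adjacent t j i) height_coef t j <
   (height_coef t i).*2)%N.
Proof.
case: t => [n|n|||].
- case: i => [|i] ilt.
  + apply: (@height_gt_aux _ _ [:: 1%N]).
      move=> j; rewrite /adjacent /= !inE; lia.
    rewrite big_seq1 /=; nia.
  + apply: (@height_gt_aux _ _ [:: i; i.+2]).
      move=> j; rewrite /adjacent /= !inE; lia.
    rewrite big_cons big_seq1 /=; move: ilt => /=; nia.
- move=> ilt; apply: (@height_gt_aux _ _ (if i == 0 then [:: 1]%N else
     if (i < n.+1)%N then [:: i.-1; i.+1] else
     if i == n.+1 then [:: n; n.+2; n.+3] else [:: n.+1])).
    move=> j jlt; rewrite /adjacent /= /branch_edge /=; move: jlt => /=.
    do ![case: ifP]; rewrite !inE; lia.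
  rewrite /= in ilt.
  case: ifP => [/eqP -> |i0].
    rewrite big_seq1 /=; do ?[case: ifP]; nia.
  case: ifP => [i1|i1].
    rewrite big_cons big_seq1 /=; do ![case: ifP]; nia.
  case: ifP => [/eqP -> |i2].
    rewrite !big_cons big_nil /=; do ![case: ifP]; nia.
  rewrite big_seq1 /=; do ![case: ifP]; nia.
- by do 6![case: i => [|i]; first by rewrite !big_mkcond !big_ord_recr big_ord0].
- by do 7![case: i => [|i]; first by rewrite !big_mkcond !big_ord_recr big_ord0].
- by do 8![case: i => [|i]; first by rewrite !big_mkcond !big_ord_recr big_ord0].
Qed.

Definition height t (x : wlattice t) : int :=
  \sum_(j < rank t) (height_coef t j)%:R * x j 0.

Lemma heightD t : {morph @height t : x y / x + y}.
Proof.
by move=> x y; rewrite -big_split; apply: eq_bigr => i _; rewrite mxE mulrDr.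
Qed.

Lemma alphaE t (i j : vertex t) : alpha i j 0 = cartan t j i.
Proof.
rewrite /alpha summxE (bigD1 j) //= !mxE !eqxx mulr1 big1 ?addr0 // => k kj.
by rewrite !mxE [j == k]eq_sym (negbTE kj) mulr0.
Qed.

Lemma height_alpha t (i : vertex t) : 0 < height (alpha i).
Proof.
rewrite /height (bigD1 i) //= alphaE mxE eqxx.
rewrite (eq_bigr (fun j : vertex t =>
  - (if adjacent t j i then height_coef t j else 0%N)%:R)); last first.
  move=> j ji; rewrite alphaE mxE (negbTE ji).
  by case: ifP => _; rewrite ?mulrN1 ?mulr0.
rewrite sumrN -natr_sum -big_mkcondr /= mulr_natr -mulrnA muln2 subr_gt0.
rewrite ltr_nat; apply: leq_ltn_trans (height_gt (ltn_ord i)).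
rewrite [leqLHS]big_mkcond [leqRHS]big_mkcond; apply: leq_sum => j _.
by case: (j != i).
Qed.

Lemma height_Qplus t (a : {ffun vertex t -> nat}) (i : vertex t) :
  (a i)%:Z <= height (\sum_i alpha i *+ a i).
Proof.
have h0 : height (0 : wlattice t) = 0.
  by rewrite /height big1 // => j _; rewrite mxE mulr0.
have hn (j : vertex t) n : n%:Z <= height (alpha j *+ n).
  elim: n => [|n IH]; first by rewrite /height big1 // => k _; rewrite mulr0n mxE mulr0.
  by rewrite mulrS heightD -add1n PoszD lerD // -gtz0_ge1 height_alpha.
rewrite (big_morph _ (@heightD t) h0) (bigD1 i) //=.
by apply: le_trans (hn i (a i)) _; rewrite lerDl sumr_ge0 // => j _;
  apply: le_trans (hn j (a j)).
Qed.

Lemma Qplus_fin t v : finite_set [set x | Qplus t x /\ Qplus t (v - x)].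
Proof.
pose N := `|height v|%N.
pose F (a : {ffun vertex t -> 'I_N.+1}) : wlattice t := \sum_i alpha i *+ a i.
apply: (@sub_finite_set _ _ (F @` [set: _])); last first.
  by apply: finite_image; apply: finite_finset.
move=> x /= [[a xa] [b vb]].
have aN i : (a i < N.+1)%N.
  have ha := height_Qplus a i; have hb := height_Qplus b i.
  rewrite -xa -vb in ha hb; have := heightD x (v - x).
  rewrite [x + _]addrC subrK /N => E; lia.
exists [ffun i => Ordinal (aN i)] => //; rewrite xa.
by apply: eq_bigr => i _; rewrite ffunE.
Qed.

Definition sref t (i : vertex t) : 'M[int]_(rank t) :=
  1%:M - alpha i *m (delta_mx 0 i : 'rV_(rank t)).

Lemma srefE t (i : vertex t) (x : wlattice t) :
  sref i *m x = x - x i 0 *: alpha i.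
Proof.
rewrite mulmxBl mul1mx -mulmxA -rowE; congr (_ - _); apply/matrixP => j k.
by rewrite !mxE big_ord1 !mxE mulrC (ord1 k).
Qed.

Lemma sref_invol t (i : vertex t) : sref i *m sref i = 1%:M.
Proof.
apply/matrixP => k j.
suff E (x : wlattice t) : sref i *m (sref i *m x) = x.
  move: (E (delta_mx j 0)) => /matrixP/(_ k 0).
  by rewrite mulmxA -colE mxE => ->; rewrite !mxE andbT.
have xi : (sref i *m x) i 0 = - x i 0.
  by rewrite srefE; move: (alphaE i i); rewrite !mxE eqxx => ->; ring.
by rewrite [LHS]srefE xi scaleNr opprK srefE subrK.
Qed.

Definition word_mx t (s : seq (vertex t)) : 'M[int]_(rank t) :=
  foldr (fun i M => sref i *m M) 1%:M s.

Lemma word_mx_cat t (s1 s2 : seq (vertex t)) :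
  word_mx (s1 ++ s2) = word_mx s1 *m word_mx s2.
Proof.
by elim: s1 => [|i s IH] /=; rewrite ?mul1mx // IH mulmxA.
Qed.

Lemma word_mx_inj t (s : seq (vertex t)) :
  injective (mulmx (word_mx s) : wlattice t -> wlattice t).
Proof.
elim: s => [|i s IH] x y /=; first by rewrite !mul1mx.
rewrite -!mulmxA => /(congr1 (mulmx (sref i))).
by rewrite !mulmxA sref_invol !mul1mx => /IH.
Qed.

(* The Weyl group, acting faithfully on the weight lattice: the matrices
   that are products of simple reflections. *)
Record weyl t := Weyl {
  wmx : 'M[int]_(rank t);
  wmxP : exists s : seq (vertex t), wmx = word_mx s }.

Definition wone t : weyl t := @Weyl t 1%:M (ex_intro _ [::] erefl).

Definition wsimple t (i : vertex t) : weyl t :=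
  @Weyl t (sref i) (ex_intro _ [:: i] (esym (mulmx1 (sref i)))).

Fact wmul_subproof t (u v : weyl t) :
  exists s : seq (vertex t), wmx u *m wmx v = word_mx s.
Proof.
have [[s ->] [s' ->]] := (wmxP u, wmxP v).
by exists (s ++ s'); rewrite word_mx_cat.
Qed.
Definition wmul t (u v : weyl t) : weyl t := Weyl (wmul_subproof u v).

Definition wact t (w : weyl t) (x : wlattice t) : wlattice t := wmx w *m x.

Lemma wmx_inj t (w : weyl t) :
  injective (mulmx (wmx w) : wlattice t -> wlattice t).
Proof. by have [s ->] := wmxP w; apply: word_mx_inj. Qed.

Definition has_word_of_size t (w : weyl t) (n : nat) : bool :=
  `[< exists2 s : seq (vertex t), size s = n & wmx w = word_mx s >].

Fact wlen_subproof t (w : weyl t) : exists n, has_word_of_size w n.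
Proof. by have [s ws] := wmxP w; exists (size s); apply/asboolP; exists s. Qed.
Definition wlen t (w : weyl t) : nat := ex_minn (wlen_subproof w).

Definition Cstar (R : realType) := {z : R[i] | z != 0}.

Section Qpow.
Variables (R : realType) (q : Cstar R).
Fact qshift_subproof (k : int) (a : Cstar R) : val a * val q ^ k != 0.
Proof. by rewrite mulf_neq0 ?expfz_neq0 ?(valP a) ?(valP q). Qed.
(* [qshift k a] is a q^k and [qpow k] is q^k. *)
Definition qshift (k : int) (a : Cstar R) : Cstar R :=
  exist _ (val a * val q ^ k) (qshift_subproof k a).

Definition Cstar1 : Cstar R := exist _ 1 (oner_neq0 _).

Definition qpow (k : int) : Cstar R := qshift k Cstar1.
End Qpow.

Section Monomials.
Variables (t : dynkin) (R : realType) (q : Cstar R).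
Notation I := (vertex t).
Notation P := (wlattice t).

Definition psi_monomial := {freeg (I * Cstar R)%type / int}.

(* Laurent monomials [l] prod Psi_(i,a)^(n_(i,a)), written additively as pairs
   (l, sum of n_(i,a) << (i, a) >>); the first projection is omega'. *)
Definition monomial := (P * psi_monomial)%type.

Definition weight_mon (l : P) : monomial := (l, 0).

Definition Psi (i : I) (a : Cstar R) : monomial := (0, << (i, a) >>).

Definition Ymon (i : I) (a : Cstar R) : monomial :=
  weight_mon (varpi i) + Psi i (qshift q (-1) a) - Psi i (qshift q 1 a).

Definition Amon (i : I) (a : Cstar R) : monomial :=
  Ymon i (qshift q (-1) a) + Ymon i (qshift q 1 a)
  - \sum_(j | cartan t i j == -1) Ymon j a.

Definition Psi_tilde (i : I) (a : Cstar R) : monomial :=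
  - Psi i a + \sum_(j | cartan t i j == -1) Psi j (qshift q 1 a).

Lemma cartan_sym (i j : I) : cartan t i j = cartan t j i.
Proof. by rewrite !mxE eq_sym /adjacent orbC. Qed.

Lemma Amon_weight (i : I) (a : Cstar R) : (Amon i a).1 = alpha i.
Proof.
have E (j : I) b : (Ymon j b).1 = varpi j by rewrite /= addr0 subr0.
transitivity ((Ymon i (qshift q (-1) a)).1 + (Ymon i (qshift q 1 a)).1
              - (\sum_(j | cartan t i j == -1) Ymon j a).1); first by [].
rewrite !E (@big_morph _ _ (fun x : monomial => x.1) 0 +%R 0 +%R) //.
under eq_bigr do rewrite E.
rewrite [RHS]/alpha [in RHS](bigD1 i) //= [cartan t i i]mxE eqxx.
rewrite scaler_nat mulr2n; congr (_ + _).
rewrite [in RHS](bigID (fun j => cartan t i j == -1)) /= [X in _ = _ + X]big1; last first.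
  move=> j /andP[ji]; rewrite cartan_sym mxE (negbTE ji).
  by case: ifP => //; rewrite ?scale0r.
rewrite addr0 -sumrN; apply: eq_big => [j|j /eqP cij]; last first.
  by rewrite cartan_sym cij scaleN1r.
by case: eqP => cij; rewrite ?andbF // andbT; apply/esym;
   apply: contra_eqN cij => /eqP ->; rewrite mxE eqxx.
Qed.

Definition Ygrading (w : weyl t) : grading :=
  @Grading monomial P fst (mulmx (wmx w)) (Qplus t)
    (@wmx_inj t w) (@Qplus0 t) (@QplusD t) (@Qplus_fin t).

Definition Yring (w : weyl t) := fps (Ygrading w).
HB.instance Definition _ (w : weyl t) := GRing.ComNzRing.on (Yring w).

(* The Weyl group is finite, so that the direct sum is the full product. *)
Definition PiY := forall w : weyl t, Yring w.
HB.instance Definition _ := gen_eqMixin PiY.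
HB.instance Definition _ := gen_choiceMixin PiY.

Definition pi_zero : PiY := fun=> 0.
Definition pi_one : PiY := fun=> 1.
Definition pi_opp (x : PiY) : PiY := fun w => - x w.
Definition pi_add (x y : PiY) : PiY := fun w => x w + y w.
Definition pi_mul (x y : PiY) : PiY := fun w => x w * y w.

Lemma pi_ext (x y : PiY) : (forall w, x w = y w) -> x = y.
Proof. exact: functional_extensionality_dep. Qed.

Fact pi_addA : associative pi_add.
Proof. by move=> x y z; apply: pi_ext => w; apply: addrA. Qed.
Fact pi_addC : commutative pi_add.
Proof. by move=> x y; apply: pi_ext => w; apply: addrC. Qed.
Fact pi_add0 : left_id pi_zero pi_add.
Proof. by move=> x; apply: pi_ext => w; apply: add0r. Qed.
Fact pi_addN : left_inverse pi_zero pi_opp pi_add.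
Proof. by move=> x; apply: pi_ext => w; apply: addNr. Qed.
HB.instance Definition _ :=
  GRing.isZmodule.Build PiY pi_addA pi_addC pi_add0 pi_addN.

Fact pi_mulA : associative pi_mul.
Proof. by move=> x y z; apply: pi_ext => w; apply: mulrA. Qed.
Fact pi_mulC : commutative pi_mul.
Proof. by move=> x y; apply: pi_ext => w; apply: mulrC. Qed.
Fact pi_mul1 : left_id pi_one pi_mul.
Proof. by move=> x; apply: pi_ext => w; apply: mul1r. Qed.
Fact pi_mulDl : left_distributive pi_mul pi_add.
Proof. by move=> x y z; apply: pi_ext => w; apply: mulrDl. Qed.
Fact pi_one_neq0 : pi_one != pi_zero.
Proof.
by apply/eqP => /(congr1 (fun x : PiY => x (wone t)))/eqP; apply/negP/oner_neq0.
Qed.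
HB.instance Definition _ := GRing.Zmodule_isComNzRing.Build PiY
  pi_mulA pi_mulC pi_mul1 pi_mulDl pi_one_neq0.

(* Inverses in [PiY], chosen classically (junk value [x] on non-units, as
   usual), so that (1 - [-w(alpha_i)])^-1 can be written. *)
Definition pi_unit : {pred PiY} := fun x => `[< exists y : PiY, y * x = 1 >].
Definition pi_inv (x : PiY) : PiY :=
  if pselect (exists y : PiY, y * x = 1) is left h then projT1 (cid h) else x.

Fact pi_mulVx : {in pi_unit, left_inverse 1 pi_inv *%R}.
Proof.
move=> x; rewrite unfold_in => /asboolP ux; rewrite /pi_inv.
by case: pselect => // h; case: cid.
Qed.
Fact pi_unitPl (x y : PiY) : y * x = 1 -> pi_unit x.
Proof. by move=> yx; apply/asboolP; exists y. Qed.
Fact pi_inv_out : {in [predC pi_unit], pi_inv =1 id}.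
Proof.
move=> x; rewrite inE /= unfold_in => /asboolP nux; rewrite /pi_inv.
by case: pselect.
Qed.
HB.instance Definition _ := GRing.ComNzRing_hasMulInverse.Build PiY
  pi_mulVx pi_unitPl pi_inv_out.

(* The diagonal image of the monomial [m]. *)
Definition pi_mon (m : monomial) : PiY := fun w => fmon (G := Ygrading w) m.

Definition pi_weight (l : P) : PiY := pi_mon (weight_mon l).

Definition pi_cvg (u : nat -> PiY) (x : PiY) : Prop := forall w : weyl t,
  (exists s : seq P, forall n, bounded_by (G := Ygrading w) s (fsupp (u n w))) /\
  (forall l : P, exists N : nat, forall n, (N <= n)%N ->
     forall m : monomial, m.1 = l -> u n w m = x w m).

Definition pi_continuous (F : PiY -> PiY) : Prop :=
  forall u x, pi_cvg u x -> pi_cvg (fun n => F (u n)) (F x).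

Definition series (u : nat -> monomial) (m : monomial) : int :=
  \sum_(k \in [set: nat]) ((m == u k)%:R : int).

(* Junk value 0 when the support is not admissible; [Sigma_plus_admissible]
   and [Sigma_minus_admissible] show that it does not occur below. *)
Definition mkfps (G : grading) (f : gmon G -> int) : fps G :=
  if pselect (admissible (fsupp f)) is left h then Fps h else 0.

Definition Sigma_plus_terms i a (k : nat) : monomial :=
  \sum_(1 <= j < k.+1) - Amon i (qshift q (- (j.-1).*2%:Z) a).

Definition Sigma_minus_terms i a (k : nat) : monomial :=
  \sum_(1 <= j < k.+2) Amon i (qshift q j.*2%:Z a).

Lemma series_admissible (w : weyl t) (u : nat -> monomial) (b : P)
    (n : nat -> nat) :
  Qplus t b -> b != 0 -> injective n ->
  (forall k, wact w (u k).1 = - (b *+ n k)) ->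
  admissible (G := Ygrading w) (fsupp (G := Ygrading w) (series u)).
Proof.
move=> Qb b0 ninj un.
apply: (@admissibleS (Ygrading w) _ (range u)) => [m|].
  rewrite /fsupp /= => um.
  have [k _] := @fsbigN1 _ _ _ _ _ _ (fun m k => (m == u k)%:R : int) m um.
  by case: (m =P u k) => // -> _; exists k.
split.
  exists [:: 0] => _ [k _ <-]; exists 0; rewrite ?inE //= sub0r.
  rewrite [X in - X]un opprK; elim: (n k) => [|j IH].
    by rewrite mulr0n; apply: Qplus0.
  by rewrite mulrS; apply: QplusD.
move=> l /=; have [[k kl]|nk] := pselect (exists k, (u k).1 = l); last first.
  by apply: sub_finite_set (finite_set0 _) => _ [[k _ <-] kl]; apply: nk; exists k.
apply: sub_finite_set (finite_set1 (u k)) => _ [[j _ <-] jl] /=; congr u.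
apply: ninj; have : b *+ n j = b *+ n k.
  by apply: oppr_inj; rewrite -!un jl kl.
have [i bi] : exists i, b i 0 != 0.
  apply: contrapT => /forallNP b0'; move/eqP: b0; apply; apply/colP => i.
  by have /negP/negPn/eqP -> := b0' i; rewrite mxE.
move=> /(congr1 (fun x : P => x i 0)).
have E p : (b *+ p) i 0 = b i 0 * p%:R.
  by elim: p => [|p IH]; rewrite ?mulr0 ?mxE // mulrS mxE IH mulrS mulrDr mulr1.
rewrite (E (n j)) (E (n k)) => /(mulfI bi)/eqP.
by rewrite eqr_nat => /eqP.
Qed.

Lemma alpha_neq0 (i : I) : alpha i != 0.
Proof.
apply/eqP => /colP/(_ i); rewrite alphaE !mxE eqxx => /eqP; by rewrite pnatr_eq0.
Qed.

Lemma wact_alpha_neq0 (w : weyl t) (i : I) : wact w (alpha i) != 0.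
Proof.
apply: contra_neq (alpha_neq0 i) => wi.
by apply: (@wmx_inj t w); rewrite [LHS]wi mulmx0.
Qed.

Lemma Sigma_plus_admissible (w : weyl t) i a :
  Qplus t (wact w (alpha i)) ->
  admissible (G := Ygrading w)
    (fsupp (G := Ygrading w) (series (Sigma_plus_terms i a))).
Proof.
move=> Qa; apply: (series_admissible Qa (wact_alpha_neq0 w i) (n := id)) => // k.
rewrite -raddfMn -raddfN; congr wact; rewrite /Sigma_plus_terms.
rewrite (@big_morph _ _ (fun x : monomial => x.1) 0 +%R 0 +%R) //.
rewrite (eq_bigr (fun=> - alpha i)) => [|j _]; last first.
  by rewrite -[in RHS](Amon_weight i (qshift q (- (j.-1).*2%:Z) a)).
by rewrite sumr_const_nat subn1 mulNrn.
Qed.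

Lemma Sigma_minus_admissible (w : weyl t) i a :
  Qplus t (- wact w (alpha i)) ->
  admissible (G := Ygrading w)
    (fsupp (G := Ygrading w) (series (Sigma_minus_terms i a))).
Proof.
move=> Qa; apply: (series_admissible Qa _ succn_inj) => [|k].
  by rewrite oppr_eq0 wact_alpha_neq0.
rewrite mulNrn opprK -raddfMn; congr wact; rewrite /Sigma_minus_terms.
rewrite (@big_morph _ _ (fun x : monomial => x.1) 0 +%R 0 +%R) //.
rewrite (eq_bigr (fun=> alpha i)) => [|j _]; last by rewrite Amon_weight.
by rewrite sumr_const_nat subn1.
Qed.

(* Every root w(alpha_i) lies in either Q_+ or -Q_+. *)
Definition Sigma (w : weyl t) (i : I) (a : Cstar R) : Yring w :=
  if `[< Qplus t (wact w (alpha i)) >]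
  then mkfps (G := Ygrading w) (series (Sigma_plus_terms i a))
  else - mkfps (G := Ygrading w) (series (Sigma_minus_terms i a)).

Definition pi_Sigma (i : I) (a : Cstar R) : PiY := fun w => Sigma w i a.


Definition is_Theta_simple (i : I) (F : PiY -> PiY) : Prop :=
  [/\ pi_continuous F,
      (* F maps the component of w to the component of w s_i *)
      forall (w : weyl t) (x y : PiY), x w = y w ->
        F x (wmul w (wsimple i)) = F y (wmul w (wsimple i)),
      forall l : P, F (pi_weight l) = pi_weight (wact (wsimple i) l),
      forall (j : I) (a : Cstar R), j != i ->
        F (pi_mon (Psi j a)) = pi_mon (Psi j a)
    & forall a : Cstar R, F (pi_mon (Psi i a)) =
        (1 - pi_weight (- alpha i)) *
        pi_mon (Psi_tilde i (qshift q (-2) a)) * pi_Sigma i (qshift q (-2) a)].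

Definition is_Theta (Theta : weyl t -> {rmorphism PiY -> PiY}) : Prop :=
  [/\ forall x, Theta (wone t) x = x,
      forall u v x, Theta (wmul u v) x = Theta u (Theta v x)
    & forall i, is_Theta_simple i (Theta (wsimple i))].

Definition is_chi (chi : P -> PiY) : Prop :=
  (forall i, chi (varpi i) = 1) /\
  (forall (w : weyl t) (i : I), wlen (wmul w (wsimple i)) = (wlen w).+1 ->
     chi (wact (wmul w (wsimple i)) (varpi i)) * chi (wact w (varpi i)) =
     (1 - pi_weight (- wact w (alpha i)))^-1 *
     \prod_(j | j != i) chi (wact w (varpi j)) ^+ `|cartan t i j|%N).

Definition K := Yring (wone t).
HB.instance Definition _ := GRing.ComNzRing.on K.

Definition Qvar (Theta : weyl t -> {rmorphism PiY -> PiY}) (chi : P -> PiY)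
    (w : weyl t) (i : I) (a : Cstar R) : K :=
  (chi (wact w (varpi i)) * Theta w (pi_mon (Psi i a))) (wone t).

(* Power series in the A_(i,a)^-1 with constant term 1, the additive
   notation turning a product of A_(i,a)^-1 into an opposite. *)
Definition is_Ainv_series (f : K) : Prop :=
  f 0 = 1 /\
  forall m : monomial, f m != 0 ->
    exists s : seq (I * Cstar R), m = - \sum_(x <- s) Amon x.1 x.2.

Definition is_factorization (Theta : weyl t -> {rmorphism PiY -> PiY})
    (chi : P -> PiY) (psi : weyl t -> I -> Cstar R -> psi_monomial)
    (sigma : weyl t -> I -> Cstar R -> K) : Prop :=
  forall (w : weyl t) (i : I) (a : Cstar R),
    is_Ainv_series (sigma w i a) /\
    Qvar Theta chi w i a =
      fmon (G := Ygrading (wone t)) (0, psi w i a) * sigma w i a.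

(* Z[P/2] (x)_(Z[P]) K. An element l of the lattice P/2 of half weights is
   stored as 2 l in [P], so that Q_+ becomes 2 Q_+. As P has finite index in
   P/2, the tensor product is the ring of formal sums with half weights whose
   support satisfies the same conditions as in K. *)
Definition halfQplus : set P := [set x | exists2 b, Qplus t b & x = b *+ 2].

Fact halfQplus0 : halfQplus 0.
Proof. by exists 0; rewrite ?mul0rn //; apply: Qplus0. Qed.

Fact halfQplusD x y : halfQplus x -> halfQplus y -> halfQplus (x + y).
Proof.
move=> [b Qb ->] [c Qc ->]; exists (b + c); last by rewrite mulrnDl.
exact: QplusD.
Qed.

Fact double_inj : injective (fun x : P => x *+ 2).
Proof.
move=> x y /= xy; apply/colP => i; move/(congr1 (fun z : P => z i 0)): xy.
by rewrite !mulr2n !mxE -!mulr2n => /eqP; rewrite eqr_pMn2r // => /eqP.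
Qed.

Fact halfQplus_fin v : finite_set [set x | halfQplus x /\ halfQplus (v - x)].
Proof.
have [[u vu]|nv] := pselect (exists u : P, v = u *+ 2); last first.
  apply: sub_finite_set (finite_set0 _) => x [[b _ xb] [c _ vx]]; apply: nv.
  by exists (b + c); rewrite mulrnDl -xb -vx addrC subrK.
apply: sub_finite_set (finite_image (fun x : P => x *+ 2) (Qplus_fin u)).
move=> _ [[b Qb ->] [c Qc vx]]; exists b => //; split=> //.
suff -> : u - b = c by [].
by apply: double_inj; rewrite /= mulrnBl -vx vu.
Qed.

Definition half_grading : grading :=
  @Grading monomial P fst (@idfun P) halfQplus
    (@inj_id P) halfQplus0 halfQplusD halfQplus_fin.

Definition Khalf := fps half_grading.
HB.instance Definition _ := GRing.ComNzRing.on Khalf.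

(* The inclusion of P in P/2, for the above encoding. *)
Definition double_mon (m : monomial) : monomial := (m.1 *+ 2, m.2).

Definition K_to_Khalf_coef (f : K) (m : monomial) : int :=
  \sum_(m' \in [set m' | double_mon m' = m]) f m'.

Fact K_to_Khalf_subproof (f : K) :
  admissible (G := half_grading) (fsupp (G := half_grading) (K_to_Khalf_coef f)).
Proof.
apply: (@admissibleS half_grading _ (double_mon @` fsupp f)) => [m|].
  rewrite /fsupp /= => fm.
  have [m' /= <- fm'] := @fsbigN1 _ _ _ _ _ _ (fun _ : monomial => f) m fm.
  by exists m'.
have [[s sP] fin] := fcoefP f; split.
  exists [seq l *+ 2 | l <- s] => _ [m fm <-].
  have [l ls cl] := sP _ fm; exists (l *+ 2); first exact: map_f.
  exists (l - m.1); last by rewrite /= mulrnBl.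
  by move: cl; rewrite /= mul1mx.
move=> l; have [[u lu]|nl] := pselect (exists u : P, l = u *+ 2); last first.
  apply: sub_finite_set (finite_set0 _) => _ [[m _ <-] ml].
  by apply: nl; exists m.1.
apply: sub_finite_set (finite_image double_mon (fin u)).
move=> _ [[m fm <-] ml]; exists m => //; split=> //.
by apply: double_inj; rewrite -lu -ml.
Qed.

Definition K_to_Khalf (f : K) : Khalf := Fps (K_to_Khalf_subproof f).

Variable V : set (I * int).

(* Twice Omega. It sends Psi_(i,q^r) to r varpi_i for (i, r) in V, the
   exponent r being unique when q is not a root of unity; the variables
   Psi_(i,a) not of this form, outside of the domain of Omega, are sent to 0. *)
Definition Omega_Psi (x : I * Cstar R) : P :=
  xget 0 [set r : int | V (x.1, r) /\ x.2 = qpow q r] *: varpi x.1.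

Definition Omega (m : monomial) : P := m.1 *+ 2 + fglift Omega_Psi m.2.

Definition Qund (Theta : weyl t -> {rmorphism PiY -> PiY}) (chi : P -> PiY)
    (psi : weyl t -> I -> Cstar R -> psi_monomial)
    (w : weyl t) (i : I) (r : int) : Khalf :=
  fmon (G := half_grading) (- Omega (0, psi w i (qpow q r)), 0) *
  K_to_Khalf (Qvar Theta chi w i (qpow q r)).

End Monomials.

Definition arrow t (x y : vertex t * int) : Prop :=
  cartan t x.1 y.1 != 0 /\ y.2 = x.2 + cartan t x.1 y.1.

Definition is_component t (V : set (vertex t * int)) : Prop :=
  exists v, V = [set x | clos_refl_sym_trans _ (@arrow t) v x].

(* Main.v *)
Require Import Defs.
From mathcomp Require Import all_boot all_order all_algebra.
From mathcomp Require Import boolp classical_sets fsbigop.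
From mathcomp Require Import reals complex freeg ring zify.

Set Implicit Arguments.
Unset Strict Implicit.
Unset Printing Implicit Defensive.

Import Order.TTheory GRing.Theory Num.Theory.
Local Open Scope ring_scope.

(** Write a' for a q^-2. The relation comes from the simple reflection Theta_i
applied to Psi_(i,a). In every component the series
Sigma_(i,a) satisfies the two-term recurrence
  Sigma_(i,a) = 1 + A_(i,a)^-1 Sigma_(i,a'),
and A_(i,a')^-1 is, up to the weight [-alpha_i], the quotient of
Psi_tilde_(i,a' q^-2) Psi_(i,a) by the product of the Psi_(j,a q^-1) over the
neighbours j of i. Hence the unknown series cancels in
  Theta_i(Psi_(i,a)) Psi_(i,a') - [-alpha_i] Theta_i(Psi_(i,a')) Psi_(i,a)
    = (1 - [-alpha_i]) prod_j Psi_(j,a q^-1)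
([Theta_simple_Psi]). Applying Theta_w, multiplying by chi_(w s_i(varpi_i))
chi_(w(varpi_i)) and projecting to the component of the identity gives the
relation [QQ_relation] in K, with the coefficient [-w(alpha_i)] on its second
term. The division by 1 - [-w(alpha_i)], and the recurrence itself, require
that every root is positive or negative ([wact_alpha_sign]).

The normalization by Omega absorbs this coefficient. Since l(w s_i) > l(w)
makes w(alpha_i) positive ([wact_alpha_pos]), the second term of the relation
has only weights < 0; comparing the parts of weight 0 gives a recursion
for the leading monomials Psi_(w(varpi_i),a) ([psi_wmul_eq]). By induction on
the length of w it follows that Omega(Psi_(w(varpi_i),q^r)) increases by
w(varpi_i) when r increases by 2 ([lead_Omega_shift]), and
w(varpi_i) - w s_i(varpi_i) = w(alpha_i) is exactly the weight to be
absorbed. *)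

(** * Positive and negative roots, and the length function *)

Section Roots.
Variable t : dynkin.
Implicit Types (x y : 'cV[int]_(rank t)) (i j k : vertex t).
Implicit Types (s : seq (vertex t)).

(** Vectors x, y here are coordinates in the basis of simple roots, and [form]
is the invariant bilinear form on the root lattice. *)
Definition form x y : int := (x^T *m cartan t *m y) 0 0.

Lemma tr_cartan : (cartan t)^T = cartan t.
Proof. by apply/matrixP => i j; rewrite mxE cartan_sym. Qed.

Lemma cartan_delta i : cartan t *m delta_mx i 0 = alpha i.
Proof. by apply/colP => j; rewrite -colE mxE alphaE. Qed.

Lemma cartan_le0 i j : i != j -> cartan t i j <= 0.
Proof. by move=> ij; rewrite mxE (negbTE ij); case: ifP. Qed.

Lemma formE x y : form x y = \sum_i \sum_j x i 0 * cartan t i j * y j 0.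
Proof.
rewrite /form -mulmxA mxE; apply: eq_bigr => i _.
rewrite !mxE mulr_sumr; apply: eq_bigr => j _.
by rewrite mulrA.
Qed.

Lemma formC x y : form x y = form y x.
Proof.
rewrite /form -[in RHS](trmxK (_ *m x)) [in RHS]mxE !trmx_mul trmxK tr_cartan.
by rewrite mulmxA.
Qed.

Lemma formB x y : form (x - y) (x - y) = form x x + form y y - form x y *+ 2.
Proof.
rewrite mulr2n {2}(formC x y) /form [(_ - _)^T]linearB /=.
by rewrite !mulmxBl !mulmxBr !mxE; ring.
Qed.

Lemma height_coef_gt0 i : (0 < height_coef t i)%N.
Proof. by have := height_gt (ltn_ord i); case: height_coef. Qed.

(** The vector h of [height_coef] is positive and C h is positive, C being the
Cartan matrix. Since the off-diagonal entries of C are nonpositive, putting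
z_i = x_i / h_i, the identity
  x^T C x = sum_i h_i (C h)_i z_i^2 - 1/2 sum_(i,j) c_ij h_i h_j (z_i - z_j)^2
shows that C is positive definite. *)
Lemma form_gt0 x : x != 0 -> 0 < form x x.
Proof.
move=> x0; rewrite -(ltr_int rat) formE rmorph_sum /=.
under eq_bigr do rewrite rmorph_sum /=.
pose h i : rat := (height_coef t i)%:R.
pose c i j : rat := (cartan t i j)%:~R.
pose z i : rat := (x i 0)%:~R / h i.
have h0 i : 0 < h i by rewrite ltr0n height_coef_gt0.
have cC i j : c i j = c j i by rewrite /c cartan_sym.
pose S i : rat := \sum_j c i j * h j.
have S0 i : 0 < S i.
  have := height_alpha i; rewrite -(ltr_int rat) /height rmorph_sum /=.
  congr (_ < _); apply: eq_bigr => j _.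
  by rewrite alphaE rmorphM rmorph_nat cC mulrC.
pose T : rat := \sum_i \sum_j - (c i j * h i * h j * (z i - z j) ^+ 2).
have T0 : 0 <= T.
  apply: sumr_ge0 => i _; apply: sumr_ge0 => j _.
  have [->|ij] := eqVneq i j; first by rewrite subrr expr0n /= mulr0 oppr0.
  rewrite oppr_ge0 mulr_le0_ge0 ?sqr_ge0 ?(mulr_le0_ge0 _ (ltW (h0 _))) //.
  by rewrite /c lerz0 cartan_le0.
suff E : (\sum_i \sum_j ((x i 0 * cartan t i j * x j 0)%:~R : rat)) *+ 2 =
    (\sum_i h i * z i ^+ 2 * S i) *+ 2 + T.
  rewrite -(pmulrn_lgt0 _ (ltn0Sn 1)) E ltr_wpDr // pmulrn_lgt0 //.
  have [i xi] : exists i, x i 0 != 0.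
    apply: contrapT => /forallNP x0'; case/eqP: x0; apply/colP => i.
    by have /negP/negPn/eqP -> := x0' i; rewrite mxE.
  rewrite (bigD1 i) //= ltr_wpDr //.
    apply: sumr_ge0 => j _; apply: mulr_ge0; last exact: ltW.
    by apply: mulr_ge0; [exact: ltW | exact: sqr_ge0].
  rewrite mulr_gt0 // mulr_gt0 // lt0r sqr_ge0 andbT expf_eq0 /= mulf_eq0.
  by rewrite invr_eq0 intr_eq0 negb_or xi gt_eqF.
have E1 : \sum_i h i * z i ^+ 2 * S i =
    \sum_i \sum_j c i j * h i * h j * z i ^+ 2.
  apply: eq_bigr => i _; rewrite /S mulr_sumr; apply: eq_bigr => j _; ring.
have E2 : \sum_i h i * z i ^+ 2 * S i =
    \sum_i \sum_j c i j * h i * h j * z j ^+ 2.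
  rewrite E1 exchange_big; apply: eq_bigr => i _; apply: eq_bigr => j _.
  by rewrite cC; ring.
rewrite [in RHS]mulr2n {1}E1 E2 /T -!big_split -sumrMnl; apply: eq_bigr => i _.
rewrite -!big_split -sumrMnl; apply: eq_bigr => j _ /=.
have hn k : h k != 0 by rewrite gt_eqF.
rewrite !rmorphM /= -/(c i j) /z; field.
by rewrite !hn.
Qed.

(** As the diagonal entries of the Cartan matrix are 2, they can be halved, and
the form is twice an integral quadratic form. *)
Lemma cartan_half : exists B : 'M[int]_(rank t), cartan t = B + B^T.
Proof.
exists (\matrix_(i, j) if i == j then 1 else
                       if (i < j)%N then cartan t i j else 0).
apply/matrixP => i j; rewrite [in RHS]mxE [X in _ = X + _]mxE.
rewrite [X in _ = _ + X]mxE [X in _ = _ + X]mxE [j == i]eq_sym (cartan_sym j i).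
have [->|ij] := eqVneq i j; first by rewrite mxE eqxx.
case: ltngtP => [||/val_inj ij']; rewrite ?addr0 ?add0r //.
by rewrite ij' eqxx in ij.
Qed.

Lemma form_even x : exists n, form x x = n *+ 2.
Proof.
have [B CB] := cartan_half; exists ((x^T *m B *m x) 0 0).
rewrite /form CB mulmxDr mulmxDl mxE mulr2n; congr (_ + _).
by rewrite -[in RHS](trmxK (_ *m x)) [in RHS]mxE !trmx_mul trmxK mulmxA.
Qed.

Lemma form_ge2 x : x != 0 -> 2 <= form x x.
Proof.
by move=> /form_gt0; have [n ->] := form_even x; rewrite mulr2n; lia.
Qed.

Definition nonneg x := forall i, 0 <= x i 0.

(** The roots are the vectors of norm 2. If x = p - n is the decomposition into
positive and negative parts, their disjoint supports give form p n <= 0,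
so 2 = form x x >= form p p + form n n. As the form is even and positive
definite, p and n cannot both be nonzero. *)
Lemma root_sign x : form x x = 2 -> nonneg x \/ nonneg (- x).
Proof.
move=> x2.
pose p : 'cV[int]_(rank t) := \col_i Num.max (x i 0) 0.
pose n : 'cV[int]_(rank t) := \col_i Num.max (- x i 0) 0.
have xpn : x = p - n by apply/colP => i; rewrite !mxE; lia.
have pn0 : form p n <= 0.
  rewrite formE; apply: sumr_le0 => i _; apply: sumr_le0 => j _.
  have [->|/cartan_le0 ij] := eqVneq i j.
    rewrite !mxE; case: (lerP (x j 0) 0) => xj.
      by case: (lerP (- x j 0) 0) => xj2; nia.
    by case: (lerP (- x j 0) 0) => xj2; nia.
  by rewrite mulr_le0_ge0 ?mulr_ge0_le0 // !mxE le_max lexx orbT.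
have [p0|/form_ge2 p2] := eqVneq p 0.
  by right => i; rewrite xpn p0 !mxE; lia.
have [n0|/form_ge2 n2] := eqVneq n 0.
  by left => i; rewrite xpn n0 !mxE; lia.
by move: x2; rewrite xpn formB mulr2n; lia.
Qed.

(** In the coordinates of the simple roots, a simple reflection acts by the
transpose of its matrix on the weight lattice. *)
Lemma srefTE i x : (sref i)^T *m x = x - (cartan t *m x) i 0 *: delta_mx i 0.
Proof.
rewrite /sref linearB /= trmx1 mulmxBl mul1mx trmx_mul trmx_delta -mulmxA.
congr (_ - _); apply/colP => j; rewrite mxE big_ord1 [in RHS]mxE mulrC.
congr (_ * _); rewrite -[in LHS]cartan_delta trmx_mul tr_cartan -mulmxA.
by rewrite trmx_delta -rowE mxE.
Qed.

Lemma cartan_srefT i : cartan t *m (sref i)^T = sref i *m cartan t.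
Proof.
rewrite /sref linearB /= trmx1 mulmxBl mulmxBr mul1mx mulmx1 trmx_mul.
rewrite trmx_delta mulmxA cartan_delta -mulmxA -{3}tr_cartan -trmx_delta.
by rewrite -trmx_mul cartan_delta.
Qed.

Lemma form_srefT i x : form ((sref i)^T *m x) ((sref i)^T *m x) = form x x.
Proof.
rewrite /form trmx_mul trmxK -!mulmxA [cartan t *m (_ *m _)]mulmxA cartan_srefT.
by rewrite !mulmxA -[x^T *m _ *m sref i]mulmxA sref_invol mulmx1.
Qed.

(** A simple reflection changes one coordinate only, and a root has coordinates
of one sign: a positive root made negative by s_i is supported on i. *)
Lemma root_neg_simple i x : form x x = 2 -> nonneg x ->
  ~ nonneg ((sref i)^T *m x) -> x = delta_mx i 0.
Proof.
move=> x2 x0 nsx.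
have [//|sx] := root_sign (etrans (form_srefT i x) x2).
have xj j : j != i -> x j 0 = 0.
  move=> ji; have := sx j; rewrite srefTE !mxE (negbTE ji) /= mulr0 subr0.
  by have := x0 j; lia.
have xE : x = x i 0 *: delta_mx i 0.
  apply/colP => j; rewrite !mxE; have [->|/xj ->] := eqVneq j i.
    by rewrite mulr1.
  by rewrite mulr0.
have : x i 0 * x i 0 = 1.
  have : form x x = x i 0 * x i 0 * 2.
    rewrite formE (bigD1 i) //= [X in _ + X]big1 => [|j /xj xj0]; last first.
      by rewrite big1 // => k _; rewrite xj0 !mul0r.
    rewrite (bigD1 i) //= [X in _ + X + _]big1 => [|j /xj xj0]; last first.
      by rewrite xj0 mulr0.
    by rewrite mxE eqxx; ring.
  by rewrite x2; lia.
by move: (x0 i) => xi xi2; rewrite xE (_ : x i 0 = 1) ?scale1r //; nia.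
Qed.

(** The action of a product of simple reflections on the coordinates in the
simple roots; it is the transposed inverse of [word_mx] ([tr_coword_word]). *)
Definition coword_mx s : 'M[int]_(rank t) :=
  foldr (fun i M => (sref i)^T *m M) 1%:M s.

Lemma cartan_coword s : cartan t *m coword_mx s = word_mx s *m cartan t.
Proof.
elim: s => [|i s IH] /=; first by rewrite mulmx1 mul1mx.
by rewrite mulmxA cartan_srefT -mulmxA IH mulmxA.
Qed.

Lemma tr_coword_word s : (coword_mx s)^T *m word_mx s = 1%:M.
Proof.
elim: s => [|i s IH] /=; first by rewrite mulmx1 trmx1.
rewrite trmx_mul trmxK !mulmxA -[_ *m sref i *m sref i]mulmxA.
by rewrite sref_invol mulmx1.
Qed.

Lemma coword_root s i :
  form (coword_mx s *m delta_mx i 0) (coword_mx s *m delta_mx i 0) = 2.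
Proof.
elim: s => [|j s IH] /=; last by rewrite -mulmxA form_srefT.
by rewrite mul1mx /form trmx_delta -rowE -colE !mxE eqxx.
Qed.

(** The relation u s_i u^-1 = s_(u(alpha_i)), when u(alpha_i) = alpha_k. *)
Lemma word_sref s i k :
  coword_mx s *m delta_mx i 0 = delta_mx k 0 :> 'cV_(rank t) ->
  word_mx s *m sref i = sref k *m word_mx s.
Proof.
move=> sik; rewrite /sref mulmxBl mulmxBr mulmx1 mul1mx; congr (_ - _).
rewrite -[in LHS]cartan_delta -[in RHS]cartan_delta !mulmxA -cartan_coword.
rewrite -[_ *m coword_mx s *m _]mulmxA sik -!mulmxA; do 2 congr (_ *m _).
have <- : (delta_mx k 0 : 'cV[int]_(rank t))^T = delta_mx 0 k.
  by rewrite trmx_delta.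
by rewrite -sik trmx_mul -mulmxA tr_coword_word mulmx1 trmx_delta.
Qed.

(** The exchange property: when s(alpha_i) is negative, some letter k of s is
the first, from the right, to make the image of alpha_i negative; before it
that image is alpha_k by [root_neg_simple], and s_i cancels the letter k by
[word_sref]. *)
Lemma word_exchange s i : ~ nonneg (coword_mx s *m delta_mx i 0) ->
  exists2 s', size s = (size s').+1 & word_mx s' = word_mx s *m sref i.
Proof.
elim: s => [|k s IH] /= neg.
  by case: neg => j; rewrite mul1mx mxE; case: (_ && _).
have [pos|/IH [s' ss' ws']] := pselect (nonneg (coword_mx s *m delta_mx i 0)).
  have sik : coword_mx s *m delta_mx i 0 = delta_mx k 0 :> 'cV_(rank t).
    by apply: root_neg_simple => //; [apply: coword_root | rewrite mulmxA].
  by exists s => //; rewrite -mulmxA (word_sref sik) mulmxA sref_invol mul1mx.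
by exists (k :: s'); rewrite /= ?ss' // ws' mulmxA.
Qed.

Lemma nonneg_Qplus x : nonneg x -> Qplus t (cartan t *m x).
Proof.
move=> x0; exists [ffun i => `|x i ord0|%N].
apply/colP => j; rewrite mxE summxE; apply: eq_bigr => i _.
by rewrite ffunE mulmxnE alphaE -mulr_natr natz gez0_abs.
Qed.

Lemma weyl_eq (u v : weyl t) : wmx u = wmx v -> u = v.
Proof.
case: u v => [u uP] [v vP] /= uv; subst v; congr Weyl; exact: Prop_irrelevance.
Qed.

Lemma wact_alpha (w : weyl t) s i : wmx w = word_mx s ->
  wact w (alpha i) = cartan t *m (coword_mx s *m delta_mx i 0).
Proof.
by move=> ws; rewrite /wact ws mulmxA cartan_coword -mulmxA cartan_delta.
Qed.

Lemma wact_alpha_sign (w : weyl t) i :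
  Qplus t (wact w (alpha i)) \/ Qplus t (- wact w (alpha i)).
Proof.
have [s ws] := wmxP w; rewrite (wact_alpha i ws).
have [p|n] := root_sign (coword_root s i); first by left; apply: nonneg_Qplus.
by right; rewrite -mulmxN; apply: nonneg_Qplus.
Qed.

Lemma wlenP (w : weyl t) : exists2 s, size s = wlen w & wmx w = word_mx s.
Proof. by rewrite /wlen; case: ex_minnP => n /asboolP. Qed.

Lemma wlen_le (w : weyl t) s : wmx w = word_mx s -> (wlen w <= size s)%N.
Proof.
move=> ws; rewrite /wlen; case: ex_minnP => n _; apply.
by apply/asboolP; exists s.
Qed.

(** If w(alpha_i) were negative, the exchange property would shorten a reduced
word of w by right multiplication by s_i. *)
Lemma wact_alpha_pos (w : weyl t) i :
  wlen (wmul w (wsimple i)) = (wlen w).+1 -> Qplus t (wact w (alpha i)).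
Proof.
move=> wsi; have [s ss ws] := wlenP w; rewrite (wact_alpha i ws).
have [p|/word_exchange [s' s's ws']] :=
  pselect (nonneg (coword_mx s *m delta_mx i 0)); first exact: nonneg_Qplus.
have : (wlen (wmul w (wsimple i)) <= size s')%N.
  by apply: wlen_le; rewrite /= ws ws'.
by rewrite wsi -ss s's; lia.
Qed.

(** Induction along reduced words: every step increases the length. *)
Lemma weyl_ind (Pr : weyl t -> Prop) : Pr (wone t) ->
  (forall w i, wlen (wmul w (wsimple i)) = (wlen w).+1 -> Pr w ->
     Pr (wmul w (wsimple i))) ->
  forall w, Pr w.
Proof.
move=> P1 PS w; have [n wn] := ubnP (wlen w); elim: n w wn => // n IH w wn.
have [s ss ws] := wlenP w; case/lastP: s => [|s i] in ss ws *.
  by rewrite (_ : w = wone t) //; apply: weyl_eq.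
pose v : weyl t := Weyl (ex_intro _ s erefl).
have vw : w = wmul v (wsimple i).
  by apply: weyl_eq; rewrite /= ws -cats1 word_mx_cat /= mulmx1.
have vs : (wlen v <= size s)%N by apply: wlen_le.
have [s' ss' vs'] := wlenP v.
have wv : (wlen w <= (wlen v).+1)%N.
  rewrite -ss' -(size_rcons s' i); apply: wlen_le.
  by rewrite vw -cats1 word_mx_cat -vs' /= mulmx1.
rewrite size_rcons in ss.
have E : wlen w = (wlen v).+1 by lia.
by rewrite vw; apply: PS; [rewrite -vw | apply: IH; lia].
Qed.

Lemma wact_wsimple_varpi (w : weyl t) i k :
  wact (wmul w (wsimple k)) (varpi i) =
  if i == k then wact w (varpi i) - wact w (alpha i) else wact w (varpi i).
Proof.
rewrite /wact /= -mulmxA srefE [varpi i k 0]mxE eq_sym andbT.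
have [<-|_] := eqVneq i k; first by rewrite scale1r mulmxBr.
by rewrite scale0r subr0.
Qed.

Lemma alpha_varpi i :
  alpha i + \sum_(j | cartan t i j == -1) varpi j = varpi i *+ 2.
Proof.
rewrite /alpha (bigD1 i) //= [cartan t i i]mxE eqxx scaler_nat.
rewrite (bigID (fun j => cartan t i j == -1)) /= [X in _ + (_ + X)]big1.
  rewrite addr0 -addrA -[RHS]addr0; congr (_ + _).
  rewrite (eq_bigl (fun j => cartan t i j == -1)) => [|j].
    rewrite -big_split big1 //= => j /eqP; rewrite cartan_sym => ->.
    by rewrite scaleN1r addNr.
  rewrite andb_idl // => /eqP; apply: contra_eqN => /eqP ->.
  by rewrite mxE eqxx.
move=> j /andP[ji]; rewrite cartan_sym mxE (negbTE ji).
by case: ifP => // _ _; exact: scale0r.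
Qed.

Lemma height0 : height (0 : wlattice t) = 0.
Proof. by rewrite /height big1 // => j _; rewrite mxE mulr0. Qed.

Lemma heightN (x : wlattice t) : height (- x) = - height x.
Proof. by apply/eqP; rewrite -addr_eq0 -heightD addNr height0. Qed.

Lemma alpha_mulrn_inj i : injective (fun n : nat => alpha i *+ n).
Proof.
have H (n : nat) : height (alpha i *+ n) = height (alpha i) * n%:R.
  elim: n => [|n IH]; first by rewrite mulr0n mulr0 height0.
  by rewrite mulrS heightD IH -[n.+1]addn1 natrD mulrDr mulr1 addrC.
move=> m n /(congr1 (@height t)); rewrite !H => /mulfI E.
by have /eqP := E (lt0r_neq0 (height_alpha i)); rewrite eqr_nat => /eqP.
Qed.

Lemma height_Qplus_ge0 (x : wlattice t) : Qplus t x -> 0 <= height x.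
Proof.
move=> [a ->]; elim/big_ind: _ => [|u v u0 v0|i _]; first by rewrite height0.
  by rewrite heightD addr_ge0.
elim: (a i) => [|n IH]; first by rewrite mulr0n height0.
by rewrite mulrS heightD addr_ge0 // ltW // height_alpha.
Qed.

Lemma Qplus_eq0 (x : wlattice t) : Qplus t x -> Qplus t (- x) -> x = 0.
Proof.
move=> [a xa] /height_Qplus_ge0; rewrite heightN => hx.
rewrite xa big1 // => i _; have := height_Qplus a i; rewrite -xa => hi.
by rewrite (_ : a i = 0%N) ?mulr0n //; lia.
Qed.

End Roots.

(** * Monomials and geometric series in rings of formal sums *)

Section FormalSums.
Variable G : grading.
Implicit Types (f g : fps G) (a b m : gmon G).

Lemma fmulE f g m : (f * g) m = conv f g m.
Proof. by []. Qed.

Lemma fmon_mulE a f m : (fmon a * f) m = f (m - a).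
Proof.
rewrite fmulE (@convE _ _ _ _ [set a]%classic) => [|x /=]; last first.
  by case: (x =P a).
by rewrite fsbig_set1 /= eqxx mul1r.
Qed.

Lemma fmonD a b : fmon a * fmon b = fmon (a + b) :> fps G.
Proof.
apply: fpsP => m; rewrite fmon_mulE /=; congr (nat_of_bool _)%:R.
by rewrite subr_eq addrC.
Qed.

Lemma mkfpsE (f : gmon G -> int) : admissible (fsupp f) -> mkfps f =1 f.
Proof. by rewrite /mkfps => af m; case: pselect. Qed.

End FormalSums.

Section Pi.
Variables (t : dynkin) (R : realType) (q : Cstar R).
Notation P := (wlattice t).
Notation monomial := (monomial t R).
Notation PiY := (PiY t R).
Notation YG := (Ygrading R).
Implicit Types (i : vertex t) (a : Cstar R) (w : weyl t).

(** The terms of [u] being distinct, the sum has at most one nonzero term. *)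
Lemma seriesE (u : nat -> monomial) m : injective u ->
  series u m = (`[< exists k, m = u k >])%:R.
Proof.
move=> uI; rewrite /series; case: asboolP => [[k ->]|nk]; last first.
  by rewrite fsbig1 // => k _; case: (m =P u k) => // mk; case: nk; exists k.
rewrite -(fsbig_widen [set k]%classic) //= => [|j [_ jk]].
  by rewrite fsbig_set1 eqxx.
rewrite /preimage /=; have [kj|//] := eqVneq (u k) (u j).
by case: jk; rewrite /= (uI _ _ kj).
Qed.

(** Splitting off the first term; both the recurrence of the Sigma_(i,a) and the
inversion of 1 - [-alpha_i] are instances. *)
Lemma mkfps_series_rec w (u v : nat -> monomial) d :
  injective u -> (forall k, u k.+1 = d + v k) ->
  admissible (G := YG w) (fsupp (G := YG w) (series u)) ->
  admissible (G := YG w) (fsupp (G := YG w) (series v)) ->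
  mkfps (G := YG w) (series u) =
  fmon (G := YG w) (u 0%N)
  + fmon (G := YG w) d * mkfps (G := YG w) (series v).
Proof.
move=> uI uv au av.
have vI : injective v by move=> j k vjk; apply/succn_inj/uI; rewrite !uv vjk.
apply: fpsP => m; rewrite mkfpsE // seriesE //.
transitivity ((m == u 0%N)%:R + (mkfps (G := YG w) (series v) (m - d))).
  rewrite mkfpsE // seriesE //.
  have [->|m0] := eqVneq m (u 0%N).
    rewrite asboolT; last by exists 0%N.
    rewrite asboolF ?addr0 // => -[k vk].
    have : u k.+1 = u 0%N by rewrite uv -vk addrC subrK.
    by move/uI.
  rewrite add0r; congr (nat_of_bool _)%:R; apply: asbool_equiv_eq; split.
    move=> [[|k] mk]; first by rewrite mk eqxx in m0.
    by exists k; rewrite mk uv addrAC subrr add0r.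
  by move=> [k mk]; exists k.+1; rewrite uv -mk addrC subrK.
by rewrite -(fmon_mulE (G := YG w)).
Qed.

Lemma qshiftD k l a : qshift q k (qshift q l a) = qshift q (l + k) a.
Proof. by apply: val_inj; rewrite /= -mulrA -expfzDr ?(valP q). Qed.

Lemma qshift0 a : qshift q 0 a = a.
Proof. by apply: val_inj; rewrite /= expr0z mulr1. Qed.

Lemma qshift_qpow k l : qshift q l (qpow q k) = qpow q (k + l).
Proof. exact: qshiftD. Qed.

Lemma sum_fst (J : Type) (s : seq J) (p : pred J) (F : J -> monomial) :
  (\sum_(j <- s | p j) F j).1 = \sum_(j <- s | p j) (F j).1.
Proof. by rewrite (@big_morph _ _ (fun x : monomial => x.1) 0 +%R 0 +%R). Qed.

Lemma sum_snd (J : Type) (s : seq J) (p : pred J) (F : J -> monomial) :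
  (\sum_(j <- s | p j) F j).2 = \sum_(j <- s | p j) (F j).2.
Proof. by rewrite (@big_morph _ _ (fun x : monomial => x.2) 0 +%R 0 +%R). Qed.

Lemma Sigma_plus_weight i a k :
  (Sigma_plus_terms q i a k).1 = - (alpha i *+ k).
Proof.
rewrite /Sigma_plus_terms sum_fst (eq_bigr (fun=> - alpha i)) => [|j _].
  by rewrite sumr_const_nat subn1 mulNrn.
by rewrite -[in RHS](Amon_weight q i (qshift q (- (j.-1).*2%:Z) a)).
Qed.

Lemma Sigma_minus_weight i a k :
  (Sigma_minus_terms q i a k).1 = alpha i *+ k.+1.
Proof.
rewrite /Sigma_minus_terms sum_fst (eq_bigr (fun=> alpha i)) => [|j _].
  by rewrite sumr_const_nat subn1.
by rewrite Amon_weight.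
Qed.

(** The two expansions Sigma^+ and Sigma^- are solutions of one recurrence. For
Sigma^+ it splits off the term 1. For Sigma^- it is the recurrence
  Sigma^-_(i,a q^-2) = - A_(i,a) + A_(i,a) Sigma^-_(i,a)
divided by A_(i,a). *)
Lemma Sigma_rec w i a :
  Sigma q w i a =
  1 + fmon (G := YG w) (- Amon q i a) * Sigma q w i (qshift q (- 2) a).
Proof.
have b0 : qshift q (-2 + 2) a = a by rewrite addNr qshift0.
set b := qshift q (-2) a; rewrite /Sigma; case: asboolP => [wp|wn].
  rewrite (@mkfps_series_rec w _ (Sigma_plus_terms q i b) (- Amon q i a)) //.
  - by rewrite /Sigma_plus_terms big_geq.
  - move=> j k /(congr1 fst); rewrite !Sigma_plus_weight.
    by move=> /oppr_inj/alpha_mulrn_inj.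
  - move=> k; rewrite /Sigma_plus_terms big_nat_recl //=.
    congr (- Amon _ _ _ + _); first by rewrite oppr0 qshift0.
    by apply: eq_big_nat => j /andP[j0 _]; rewrite qshiftD; do 3 f_equal; lia.
  - exact: Sigma_plus_admissible.
  - exact: Sigma_plus_admissible.
have {}wn : Qplus t (- wact w (alpha i)) by case: (wact_alpha_sign w i).
rewrite (@mkfps_series_rec w (Sigma_minus_terms q i b)
  (Sigma_minus_terms q i a) (Amon q i a)) //.
- set f := mkfps _.
  have -> : Sigma_minus_terms q i b 0%N = Amon q i a.
    by rewrite /Sigma_minus_terms big_nat1 qshiftD b0.
  rewrite mulrN mulrDr mulrA !fmonD addNr.
  have -> : fmon (G := YG w) 0 = 1 by [].
  by rewrite mul1r opprD addrA subrr add0r.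
- move=> j k /(congr1 fst); rewrite !Sigma_minus_weight.
  by move=> /alpha_mulrn_inj/succn_inj.
- move=> k; rewrite /Sigma_minus_terms big_nat_recl //=; congr (_ + _).
    by rewrite qshiftD b0.
  by apply: eq_big_nat => j /andP[j0 _]; rewrite qshiftD; do 3 f_equal; lia.
- exact: Sigma_minus_admissible.
- exact: Sigma_minus_admissible.
Qed.

Lemma pi_monD (m n : monomial) : pi_mon m * pi_mon n = pi_mon (m + n) :> PiY.
Proof. by apply: pi_ext => w; apply: (fmonD (G := YG w)). Qed.

Lemma pi_mon_prod (J : finType) (p : pred J) (F : J -> monomial) :
  \prod_(j | p j) pi_mon (F j) = pi_mon (\sum_(j | p j) F j) :> PiY.
Proof.
rewrite (@big_morph _ _ (@pi_mon t R : monomial -> PiY) 1 *%R 0 +%R) //.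
by move=> x y; rewrite pi_monD.
Qed.

Lemma pi_Sigma_rec i a : pi_Sigma q i a =
  1 + pi_mon (- Amon q i a) * pi_Sigma q i (qshift q (-2) a).
Proof. by apply: pi_ext => w; apply: Sigma_rec. Qed.

Lemma one_sub_unit w (b : P) : Qplus t (wact w b) ->
  injective (fun k : nat => b *+ k) ->
  exists y, y * (1 - fmon (G := YG w) (weight_mon R (- b))) = 1.
Proof.
move=> Qb bI; pose u (k : nat) := weight_mon R (- (b *+ k)).
have uI : injective u by move=> j k /(congr1 fst) /= /oppr_inj/bI.
have wb0 : wact w b != 0.
  apply/eqP => wb; have b0 : b = 0.
    by apply: (@wmx_inj t w); rewrite [LHS]wb mulmx0.
  by have := bI 0%N 1%N; rewrite b0 !mul0rn => /(_ erefl).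
have au : admissible (G := YG w) (fsupp (G := YG w) (series u)).
  apply: (series_admissible Qb wb0 (n := id)) => // k.
  by rewrite /u /= /wact -raddfMn -raddfN.
exists (mkfps (G := YG w) (series u)); rewrite mulrC mulrBl mul1r.
rewrite {1}(@mkfps_series_rec w u u (weight_mon R (- b))) //.
  by rewrite addrK /u mulr0n oppr0.
by move=> k; rewrite /u mulrS opprD; congr pair; rewrite /= addr0.
Qed.

(** In the component of w the inverse is the geometric series in [-alpha_i] if
w(alpha_i) is positive; otherwise 1 - [-alpha_i] = - [-alpha_i](1 - [alpha_i])
and the series in [alpha_i] is used. *)
Lemma one_sub_alpha_unit i :
  exists y : PiY, y * (1 - pi_weight R (- alpha i)) = 1.
Proof.
suff H w : exists y : Yring R w,
    y * (1 - fmon (G := YG w) (weight_mon R (- alpha i))) = 1.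
  exists (fun w => projT1 (cid (H w))); apply: pi_ext => w.
  exact: (projT2 (cid (H w))).
have aI := @alpha_mulrn_inj t i.
have [wp|wn] := wact_alpha_sign w i; first exact: one_sub_unit wp aI.
have [||y y1] := @one_sub_unit w (- alpha i).
- by rewrite /wact mulmxN.
- by move=> j k; rewrite !mulNrn => /oppr_inj /aI.
pose m := fmon (G := YG w) (weight_mon R (- - alpha i)).
have mK : m * fmon (G := YG w) (weight_mon R (- alpha i)) = 1.
  by rewrite fmonD; congr fmon; congr pair; rewrite /= ?addr0 // opprK subrr.
exists (- (y * m)); rewrite mulrBr mulr1 mulNr -mulrA mK mulr1.
by rewrite opprK -y1 mulrBr mulr1 addrC.
Qed.

End Pi.

(** * The three-term relation before normalization *)

Section Action.
Variables (t : dynkin) (R : realType) (q : Cstar R).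
Notation I := (vertex t).
Notation P := (wlattice t).
Notation monomial := (monomial t R).
Notation PiY := (PiY t R).
Notation K := (K t R).
Implicit Types (i j : I) (a : Cstar R).
Variable Theta : weyl t -> {rmorphism PiY -> PiY}.
Hypothesis ThetaP : is_Theta q Theta.
Variable chi : P -> PiY.
Hypothesis chiP : is_chi chi.

Lemma Amon_snd i a : (Amon q i a).2 =
  << (i, qshift q (- 2) a) >> - << (i, qshift q 2 a) >>
  - \sum_(j | cartan t i j == -1)
      (<< (j, qshift q (-1) a) >> - << (j, qshift q 1 a) >>).
Proof.
have YE j b : (Ymon q j b).2 =
    << (j, qshift q (-1) b) >> - << (j, qshift q 1 b) >>.
  by rewrite /= add0r.
transitivity ((Ymon q i (qshift q (-1) a)).2 + (Ymon q i (qshift q 1 a)).2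
              - (\sum_(j | cartan t i j == -1) Ymon q j a).2); first by [].
rewrite sum_snd !YE (eq_bigr _ (fun j _ => YE j a)) !qshiftD; congr (_ - _).
by rewrite addNr subrr qshift0 addrA subrK.
Qed.

Lemma Theta_weight w l : Theta w (pi_weight R l) = pi_weight R (wact w l).
Proof.
have [T1 TM Ts] := ThetaP.
elim/weyl_ind: w l => [|w i _ IH] l.
  by rewrite T1 /wact mul1mx.
have [_ _ Tw _ _] := Ts i.
by rewrite TM Tw IH /wact mulmxA.
Qed.

(** With b = a q^-2, the monomial Psi_tilde_(i,b q^-2) equals
[alpha_i] m Psi_(i,a)^-1 A_(i,b)^-1, where m is the product of the
Psi_(j,a q^-1), so that the recurrence of Sigma_(i,b) makes the difference
collapse to its constant term. *)
Lemma Theta_simple_Psi i a :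
  let b := qshift q (-2) a in
  Theta (wsimple i) (pi_mon (Psi i a)) * pi_mon (Psi i b)
  - pi_weight R (- alpha i)
    * Theta (wsimple i) (pi_mon (Psi i b)) * pi_mon (Psi i a)
  = (1 - pi_weight R (- alpha i))
    * pi_mon (\sum_(j | cartan t i j == -1) Psi j (qshift q (-1) a)).
Proof.
move=> b; set m := \sum_(_ | _) _.
have [_ _ Ts] := ThetaP; have [_ _ _ _ Ti] := Ts i.
rewrite !Ti -/b (pi_Sigma_rec q i b).
set S := pi_Sigma _ _ _; set T := 1 - _.
have -> : pi_mon (Psi_tilde q i b) = pi_mon m * pi_mon (- Psi i b) :> PiY.
  rewrite pi_monD /Psi_tilde addrC; congr (pi_mon (_ + _)).
  by apply: eq_bigr => j _; rewrite qshiftD.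
have -> : pi_mon (Psi_tilde q i (qshift q (-2) b)) =
    pi_weight R (alpha i) * pi_mon m * pi_mon (- Psi i a)
    * pi_mon (- Amon q i b) :> PiY.
  rewrite /pi_weight !pi_monD; congr pi_mon.
  rewrite [Amon q i b]surjective_pairing Amon_weight Amon_snd.
  rewrite [LHS]surjective_pairing [RHS]surjective_pairing; congr pair.
    rewrite /= /m !sum_fst !big1 //.
    by rewrite !addr0 oppr0 !addr0 subrr.
  rewrite /= /m !sum_snd sumrB !qshiftD addNr qshift0 /= add0r.
  have -> : -2 + (-2 + 1) = -2 + (-1) :> int by [].
  rewrite (_ : -2 + 1 = -1 :> int) //.
  set x := << _ >>; set s3 := \sum_(_ | _) _.
  set y := << _ >>; set s1 := \sum_(_ | _) _.
  rewrite !opprD !opprK addrA [- x + y]addrC [s1 - y + _]addrA subrK.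
  by rewrite [RHS]addrC addrA subrK addrC.
have E1 c : pi_mon (Psi i c) * pi_mon (- Psi i c) = 1 :> PiY.
  by rewrite pi_monD subrr.
have E2 : pi_weight R (alpha i) * pi_weight R (- alpha i) = 1 :> PiY.
  rewrite /pi_weight pi_monD; congr pi_mon.
  by congr pair; rewrite /= ?subrr ?addr0.
clearbody T; have [Ea Eb] := (E1 a, E1 b); ring: Ea Eb E2.
Qed.

(** This is [Theta_simple_Psi] transported by Theta_w; the factor
1 - [-w(alpha_i)] on the right is cancelled by the one in the recursion of
the chi_(w(varpi_i)). *)
Lemma QQ_relation w i a :
  wlen (wmul w (wsimple i)) = (wlen w).+1 ->
  let Q := Qvar Theta chi in
  let b := qshift q (-2) a in
  Q (wmul w (wsimple i)) i a * Q w i b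
  - fmon (G := Ygrading R (wone t)) (weight_mon R (- wact w (alpha i)))
    * (Q (wmul w (wsimple i)) i b * Q w i a)
  = \prod_(j | cartan t i j == -1) Q w j (qshift q (-1) a).
Proof.
move=> wsi Q b; set v := wmul w (wsimple i).
have [T1 TM Ts] := ThetaP.
have wN : wact w (- alpha i) = - wact w (alpha i) by rewrite /wact mulmxN.
have := congr1 (Theta w) (Theta_simple_Psi i a).
rewrite !(rmorphB, rmorphM) /= -!TM -/b -/v rmorph1 !Theta_weight.
rewrite -pi_mon_prod rmorph_prod wN; set T := 1 - _ => E.
have TU : T \is a GRing.unit.
  have [y yT] := one_sub_alpha_unit R i; apply/unitrPr; exists (Theta w y).
  rewrite mulrC /T -(rmorph1 (Theta w)) -wN.
  by rewrite -Theta_weight -rmorphB -rmorphM yT rmorph1.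
have [_ /(_ w i wsi)] := chiP; rewrite -/T -/v.
have -> : \prod_(j | j != i) chi (wact w (varpi j)) ^+ `|cartan t i j|%N =
   \prod_(j | cartan t i j == -1) chi (wact w (varpi j)).
  rewrite [RHS]big_mkcond [LHS]big_mkcond; apply: eq_bigr => j _.
  rewrite mxE [j == i]eq_sym; have [//|ij] := eqVneq i j.
  by case: ifP => _; rewrite ?expr1 ?expr0.
move=> chiE.
pose F u j c : PiY := chi (wact u (varpi j)) * Theta u (pi_mon (Psi j c)).
suff: F v i a * F w i b - pi_weight R (- wact w (alpha i)) * (F v i b * F w i a)
    = \prod_(j | cartan t i j == -1) F w j (qshift q (-1) a).
  move=> /(congr1 (fun x : PiY => x (wone t))).
  by rewrite (@big_morph _ _ (fun x : PiY => x (wone t)) 1 *%R 1 *%R).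
rewrite /F big_split /=.
set A := \prod_(_ | _) _ in chiE *; set B := \prod_(_ | _) _ in E *.
have -> : A * B = T^-1 * A * (T * B) by rewrite mulrACA mulVr ?mul1r.
by rewrite -chiE -E; ring.
Qed.

End Action.

(** * Leading monomials *)

Section Leading.
Variables (t : dynkin) (R : realType) (q : Cstar R).
Notation I := (vertex t).
Notation P := (wlattice t).
Notation monomial := (monomial t R).
Notation PiY := (PiY t R).
Notation K := (K t R).
Notation KG := (Ygrading R (wone t)).
Implicit Types (i j : I) (a : Cstar R) (p : psi_monomial t R).

(** For elements of K with all weights <= 0: the part of weight 0 is the single
monomial p. *)
Definition leading (f : K) p : Prop :=
  (forall m, f m != 0 -> Qplus t (- m.1)) /\
  (forall y, f (0, y) = (y == p)%:R).

Lemma leading_inj f p p' : leading f p -> leading f p' -> p = p'.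
Proof.
by move=> [_ fp] [_ /(_ p)]; rewrite fp eqxx; case: eqP.
Qed.

Lemma leadingM f g p p' :
  leading f p -> leading g p' -> leading (f * g) (p + p').
Proof.
move=> [fQ fp] [gQ gp]; split=> [m|y].
  rewrite fmulE /conv => cm.
  have [x _] := @fsbigN1 _ _ _ _ _ _ (fun m x => f x * g (m - x)) m cm.
  rewrite mulf_eq0 => /norP [/fQ fx /gQ gx].
  rewrite (_ : - m.1 = - x.1 + - (m - x).1); first exact: QplusD.
  by rewrite /= opprB addKr.
rewrite fmulE (@convE KG f g (0, y) [set (0, p)]%classic).
  rewrite fsbig_set1 fp eqxx mul1r.
  rewrite (_ : (0, y) - (0, p) = (0, y - p)); last first.
    by congr pair; rewrite /= ?subr0.
  by rewrite gp subr_eq addrC.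
move=> [x z] fx gx.
(* two weights <= 0 of sum 0 both vanish *)
have x0 : x = 0.
  have := gQ _ gx; rewrite /= sub0r opprK => /Qplus_eq0; apply.
  exact: (fQ _ fx).
by move: fx; rewrite x0 fp; case: (z =P p) => [-> //|]; rewrite eqxx.
Qed.

Lemma leading1 : leading 1 0.
Proof.
split=> [m|y] /=; last by rewrite xpair_eqE eqxx.
by case: (m =P 0) => [-> _|] /=; [rewrite oppr0; apply: Qplus0 | ].
Qed.

Lemma leading_fmon p : leading (fmon (G := KG) (0, p)) p.
Proof.
split=> [m|y] /=; last by rewrite xpair_eqE eqxx.
by case: (m =P (0, p)) => [-> _|] /=; [rewrite oppr0; apply: Qplus0 | ].
Qed.

Lemma leading_prod (J : finType) (A : pred J) (f : J -> K)
    (p : J -> psi_monomial t R) :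
  (forall k, A k -> leading (f k) (p k)) ->
  leading (\prod_(k | A k) f k) (\sum_(k | A k) p k).
Proof.
move=> fp; elim/big_ind2: _ => //; first exact: leading1.
by move=> ? ? ? ?; apply: leadingM.
Qed.

Lemma leading_Ainv_series (f : K) : is_Ainv_series q f -> leading f 0.
Proof.
move=> [f0 fA].
have wt_sum (s : seq (I * Cstar R)) :
    (\sum_(x <- s) Amon q x.1 x.2).1 = \sum_(x <- s) alpha x.1.
  by rewrite sum_fst; apply: eq_bigr => x _; rewrite Amon_weight.
split=> [m /fA [s ->]|y].
  rewrite /= opprK wt_sum.
  elim/big_ind: _ => [|x z|x _]; [exact: Qplus0|exact: QplusD|].
  exists [ffun i => (i == x.1) : nat].
  rewrite (bigD1 x.1) //= ffunE eqxx mulr1n.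
  by rewrite big1 ?addr0 // => i ix; rewrite ffunE (negbTE ix) mulr0n.
have [->|y0] := eqVneq y 0; first exact: f0.
apply/eqP; apply: contraNT y0 => /fA [s sE].
(* a product of A_(j,b)^-1 of weight 0 is empty, since heights add up *)
suff: s = [::] by move=> s0; move: sE; rewrite s0 big_nil oppr0 => -[->].
have : height (\sum_(x <- s) alpha x.1) = 0.
  have /eqP := congr1 fst sE; rewrite /= wt_sum eq_sym oppr_eq0 => /eqP ->.
  exact: height0.
case: s {sE} => // x s; rewrite big_cons heightD => E.
have := height_alpha x.1.
have : 0 <= height (\sum_(x <- s) alpha x.1).
  elim/big_ind: _ => [|u v u0 v0|? _]; rewrite ?height0 ?heightD ?addr_ge0 //.
  by rewrite ltW // height_alpha.
by move=> s0 x0; have := ltr_wpDr s0 x0; rewrite E ltxx.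
Qed.

Variable Theta : weyl t -> {rmorphism PiY -> PiY}.
Hypothesis ThetaP : is_Theta q Theta.
Variable chi : P -> PiY.
Hypothesis chiP : is_chi chi.
Variable psi : weyl t -> I -> Cstar R -> psi_monomial t R.
Variable sigma : weyl t -> I -> Cstar R -> K.
Hypothesis psiP : is_factorization q Theta chi psi sigma.
Let Q := Qvar Theta chi.

Lemma leading_Q w i a : leading (Q w i a) (psi w i a).
Proof.
have [As QE] := psiP w i a; rewrite /Q QE -[psi w i a]addr0.
apply: leadingM; first by rewrite addr0; exact: leading_fmon.
exact: leading_Ainv_series As.
Qed.

(** By uniqueness of leading monomials, the equalities below are read off
equalities between the series Q. *)
Lemma psi_wone i a : psi (wone t) i a = << (i, a) >>.
Proof.
apply: leading_inj (leading_Q _ _ _) _; rewrite /Q /Qvar.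
have [T1 _ _] := ThetaP; have [c1 _] := chiP.
rewrite T1 /wact mul1mx c1 mul1r; exact: leading_fmon.
Qed.

Lemma psi_wmul_neq w i k a : i != k -> psi (wmul w (wsimple k)) i a = psi w i a.
Proof.
move=> ik; apply: leading_inj (leading_Q _ _ _) _.
suff -> : Q (wmul w (wsimple k)) i a = Q w i a by exact: leading_Q.
have [_ TM Ts] := ThetaP; have [_ _ _ Tk _] := Ts k.
by rewrite /Q /Qvar TM Tk // wact_wsimple_varpi (negbTE ik).
Qed.

(** Both sides are leading monomials of the right-hand side of [QQ_relation]: as
w(alpha_i) is positive, the second term there has no part of weight 0. *)
Lemma psi_wmul_eq w i a : wlen (wmul w (wsimple i)) = (wlen w).+1 ->
  psi (wmul w (wsimple i)) i a + psi w i (qshift q (-2) a) =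
  \sum_(j | cartan t i j == -1) psi w j (qshift q (-1) a).
Proof.
move=> wsi; set v := wmul w (wsimple i); set b := qshift q (-2) a.
pose QN := \prod_(j | cartan t i j == -1) Q w j (qshift q (-1) a).
have lN : leading QN
    (\sum_(j | cartan t i j == -1) psi w j (qshift q (-1) a)).
  by apply: leading_prod => j _; apply: leading_Q.
apply: (@leading_inj QN) => //; split; first by have [] := lN.
have QQ : _ = QN := QQ_relation ThetaP chiP a wsi.
have [_ l1] := leadingM (leading_Q v i a) (leading_Q w i b).
have [l2 _] := leadingM (leading_Q v i b) (leading_Q w i a).
move=> y; rewrite -QQ -l1.
set A := Q _ _ _ * Q _ _ _; set B := Q _ _ _ * Q _ _ _.
set d := weight_mon R _.
transitivity (A (0, y) - (fmon (G := KG) d * B) (0, y)); first by [].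
rewrite fmon_mulE; have [->|/l2] := eqVneq (B ((0, y) - d)) 0.
  by rewrite subr0.
rewrite /= opprK add0r => Qn.
have /eqP := Qplus_eq0 (wact_alpha_pos wsi) Qn.
by rewrite (negbTE (wact_alpha_neq0 w i)).
Qed.

Hypothesis q_not_root : forall k : nat, (0 < k)%N -> val q ^+ k <> 1.
Variable V : set (I * int).
Hypothesis Vcomp : is_component V.

Lemma component_arrow x y : arrow x y -> V x <-> V y.
Proof.
have [v ->] := Vcomp => xy; split=> /= H.
  apply: (Relation_Operators.rst_trans _ _ _ _ _ H).
  exact: Relation_Operators.rst_step.
apply: (Relation_Operators.rst_trans _ _ _ _ _ H).
apply: Relation_Operators.rst_sym.
exact: Relation_Operators.rst_step.
Qed.

Lemma V_sub2 i r : V (i, r) -> V (i, r - 2).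
Proof.
apply: (proj2 (@component_arrow (i, r - 2) (i, r) _)).
by split; rewrite /= mxE eqxx ?subrK.
Qed.

Lemma V_sub1 i j r : cartan t i j = -1 -> V (i, r) -> V (j, r - 1).
Proof.
move=> ij; apply: (proj1 (@component_arrow (i, r) (j, r - 1) _)).
by split; rewrite /= ij.
Qed.

Lemma qpow_inj : injective (qpow q).
Proof.
suff H (k l : int) : k < l -> qpow q k <> qpow q l.
  by move=> k l kl; case: (ltgtP k l) => // /H []; rewrite kl.
move=> kl /(congr1 val) /= ; rewrite !mul1r => E.
have q0 := valP q.
apply: (@q_not_root `|l - k|%N); first by lia.
rewrite -[_ ^+ _]/(val q ^ (`|l - k|%N)%:Z) gez0_abs ?subr_ge0 ?ltW //.
by rewrite expfzDr // -E -expfzDr // subrr expr0z.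
Qed.

Lemma Omega_PsiE i r : V (i, r) -> Omega_Psi q V (i, qpow q r) = r *: varpi i.
Proof.
move=> Vir; rewrite /Omega_Psi /=; congr (_ *: _).
by case: xgetP => [s -> [_ /qpow_inj]|/(_ r) []].
Qed.

Lemma fgliftD (f : I * Cstar R -> P) : {morph fglift f : x y / x + y}.
Proof.
move=> x y; have B := lift_is_additive f.
have f0 : fglift f 0 = 0 by have := B 0 0; rewrite !subrr.
by rewrite -[y in LHS]opprK B -[- y]sub0r B f0 sub0r opprK.
Qed.

Definition lead_Omega w i r : P := Omega q V (0, psi w i (qpow q r)).

Lemma lead_OmegaE w i r :
  lead_Omega w i r = fglift (Omega_Psi q V) (psi w i (qpow q r)).
Proof. by rewrite /lead_Omega /Omega /= mul0rn add0r. Qed.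

Lemma lead_Omega_rec w i r : wlen (wmul w (wsimple i)) = (wlen w).+1 ->
  lead_Omega (wmul w (wsimple i)) i r + lead_Omega w i (r - 2) =
  \sum_(j | cartan t i j == -1) lead_Omega w j (r - 1).
Proof.
move=> wsi; rewrite !lead_OmegaE -fgliftD.
have := psi_wmul_eq (qpow q r) wsi; rewrite !qshift_qpow => ->.
under [RHS]eq_bigr do rewrite lead_OmegaE.
apply: (big_morph _ (@fgliftD _)).
by apply: (addrI (fglift (Omega_Psi q V) 0)); rewrite -fgliftD !addr0.
Qed.

(** [Omega] takes doubled values, so this says that the leading monomial's Omega
increases by w(varpi_i) when r does by 2. By [lead_Omega_rec] the increments
satisfy the recursion of the weights w s_i(varpi_i) =
sum_j w(varpi_j) - w(varpi_i), the sum being over the neighbours of i. *)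
Lemma lead_Omega_shift w i r : V (i, r) ->
  lead_Omega w i r - lead_Omega w i (r - 2) = wact w (varpi i) *+ 2.
Proof.
elim/weyl_ind: w i r => [|w k wsk IH] i r Vir.
  rewrite !lead_OmegaE !psi_wone !liftU !scale1r !Omega_PsiE //; last first.
    exact: V_sub2.
  by rewrite -scalerBl opprB addrC subrK /wact mul1mx scaler_nat.
rewrite wact_wsimple_varpi; have [ik|ik] := eqVneq i k; last first.
  by rewrite !lead_OmegaE !psi_wmul_neq // -!lead_OmegaE IH.
subst k; have step s : lead_Omega (wmul w (wsimple i)) i s =
    \sum_(j | cartan t i j == -1) lead_Omega w j (s - 1)
    - lead_Omega w i (s - 2).
  by apply/eqP; rewrite eq_sym subr_eq eq_sym lead_Omega_rec.
rewrite !step opprB [X in _ + X]addrC addrACA -sumrB.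
rewrite (eq_bigr (fun j => wact w (varpi j) *+ 2)) => [|j /eqP ij]; last first.
  rewrite -(IH j (r - 1) (V_sub1 ij Vir)).
  by congr (_ - lead_Omega w j _); ring.
rewrite [X in _ + X]addrC -[X in _ + X]opprB (IH _ _ (V_sub2 Vir)).
rewrite sumrMnl -mulrnBl; congr (_ *+ 2).
rewrite /wact -mulmx_sumr -!mulmxBr; congr (_ *m _).
rewrite -[X in _ = X - _](addrK (varpi i)) -mulr2n -alpha_varpi.
by rewrite [RHS]addrAC [alpha i + _]addrC addrK.
Qed.

End Leading.

(** * Half weights *)

Section Half.
Variables (t : dynkin) (R : realType).
Notation HG := (half_grading t R).
Notation KG := (Ygrading R (wone t)).
Notation monomial := (monomial t R).
Implicit Types (f g : K t R) (m : monomial).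

Lemma double_mon_inj : injective (@double_mon t R).
Proof.
move=> [x y] [x' y'] xx'; congr pair; last exact: (congr1 snd xx').
by apply: Defs.double_inj; apply: (congr1 fst xx').
Qed.

Lemma double_monB m m' : double_mon (m - m') = double_mon m - double_mon m'.
Proof. by congr pair; rewrite /= mulrnBl. Qed.

Lemma K_to_Khalf_double f m : K_to_Khalf f (double_mon m) = f m.
Proof.
rewrite /= /K_to_Khalf_coef.
rewrite (_ : [set _ | _]%classic = [set m]%classic) ?fsbig_set1 //.
by apply/seteqP; split=> [m' /= /double_mon_inj|m' ->].
Qed.

Lemma K_to_Khalf_out f n : (forall m, double_mon m <> n) -> K_to_Khalf f n = 0.
Proof. by move=> nn; rewrite /= /K_to_Khalf_coef fsbig1 // => m /nn. Qed.

Lemma K_to_Khalf_sub f g : K_to_Khalf (f - g) = K_to_Khalf f - K_to_Khalf g.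
Proof.
apply: fpsP => n.
transitivity (K_to_Khalf f n - K_to_Khalf g n); last by [].
have [[m <-]|nn] := pselect (exists m, double_mon m = n).
  by rewrite !K_to_Khalf_double.
by rewrite !K_to_Khalf_out ?subr0 // => m mn; apply: nn; exists m.
Qed.

Lemma K_to_Khalf_fmon m :
  K_to_Khalf (fmon (G := KG) m) = fmon (G := HG) (double_mon m).
Proof.
apply: fpsP => n; have [[m' <-]|nn] := pselect (exists m, double_mon m = n).
  by rewrite K_to_Khalf_double /= (inj_eq double_mon_inj).
rewrite K_to_Khalf_out => [|m' mn]; last by apply: nn; exists m'.
by rewrite /=; case: (n =P double_mon m) => // nm; case: nn; exists m.
Qed.

Lemma K_to_Khalf_mul f g : K_to_Khalf (f * g) = K_to_Khalf f * K_to_Khalf g.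
Proof.
apply: fpsP => n; rewrite [RHS]fmulE.
rewrite (@convE HG _ _ _ (range (@double_mon t R))) => [|x fx _]; last first.
  apply: contrapT => nx; case/eqP: fx.
  by apply: K_to_Khalf_out => m mx; apply: nx; exists m.
rewrite fsbig_image; last by move=> x y _ _; apply: double_mon_inj.
have [[m <-]|nn] := pselect (exists m, double_mon m = n).
  rewrite K_to_Khalf_double fmulE; apply: eq_fsbigr => x _.
  by rewrite -double_monB !K_to_Khalf_double.
rewrite K_to_Khalf_out; last by move=> m mn; apply: nn; exists m.
rewrite fsbig1 // => x _; rewrite [X in _ * X]K_to_Khalf_out ?mulr0 // => m mn.
apply: nn; exists (m + x); rewrite -[n](subrK (double_mon x)) -mn.
by congr pair; rewrite /= mulrnDl.
Qed.

Lemma K_to_Khalf_prod (J : finType) (A : pred J) (F : J -> K t R) :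
  K_to_Khalf (\prod_(k | A k) F k) = \prod_(k | A k) K_to_Khalf (F k).
Proof.
apply: (big_morph _ K_to_Khalf_mul).
by rewrite (K_to_Khalf_fmon 0); congr fmon; congr pair; rewrite /= mul0rn.
Qed.

End Half.

Theorem proposition7p2 (t : dynkin) (R : realType) (q : Cstar R)
  (q_not_root : forall k : nat, (0 < k)%N -> val q ^+ k <> 1)
  (V : set (vertex t * int)) (V_component : is_component V)
  (Theta : weyl t -> {rmorphism PiY t R -> PiY t R})
  (Theta_spec : is_Theta q Theta)
  (chi : wlattice t -> PiY t R) (chi_spec : is_chi chi)
  (psi : weyl t -> vertex t -> Cstar R -> psi_monomial t R)
  (sigma : weyl t -> vertex t -> Cstar R -> K t R)
  (factorization : is_factorization q Theta chi psi sigma)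
  (w : weyl t) (i : vertex t) (r : int)
  (Vir : V (i, r))
  (wsi_gt : wlen (wmul w (wsimple i)) = (wlen w).+1) :
  let uQ := Qund q V Theta chi psi in
  uQ (wmul w (wsimple i)) i r * uQ w i (r - 2)
  - uQ (wmul w (wsimple i)) i (r - 2) * uQ w i r
  = \prod_(j | cartan t i j == -1) uQ w j (r - 1).
Proof.
move=> uQ; set v := wmul w (wsimple i).
pose O := lead_Omega q psi V.
pose N (x : wlattice t) := fmon (G := half_grading t R) (- x, 0).
pose kQ u j s := K_to_Khalf (Qvar Theta chi u j (qpow q s)).
have ND x y : N x * N y = N (x + y).
  by rewrite /N fmonD; congr fmon; congr pair; rewrite /= ?addr0 // opprD.
have uQE u j s : uQ u j s = N (O u j s) * kQ u j s by [].
(* weights are doubled, so [-w(alpha_i)] becomes N (w(alpha_i) *+ 2) *)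
have QQ : kQ v i r * kQ w i (r - 2)
    - N (wact w (alpha i) *+ 2) * (kQ v i (r - 2) * kQ w i r) =
    \prod_(j | cartan t i j == -1) kQ w j (r - 1).
  have -> : N (wact w (alpha i) *+ 2) = K_to_Khalf
      (fmon (G := Ygrading R (wone t)) (weight_mon R (- wact w (alpha i)))).
    by rewrite K_to_Khalf_fmon; congr fmon; rewrite /double_mon /= mulNrn.
  rewrite /kQ -!K_to_Khalf_mul -K_to_Khalf_sub -K_to_Khalf_prod.
  congr K_to_Khalf; rewrite -!qshift_qpow.
  exact: (QQ_relation Theta_spec chi_spec (qpow q r) wsi_gt).
have O1 : O v i r + O w i (r - 2) =
    \sum_(j | cartan t i j == -1) O w j (r - 1).
  exact: (lead_Omega_rec Theta_spec chi_spec factorization).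
have O2 : O v i (r - 2) + O w i r =
    wact w (alpha i) *+ 2 + (O v i r + O w i (r - 2)).
  have S u : O u i r = wact u (varpi i) *+ 2 + O u i (r - 2).
    by rewrite -(lead_Omega_shift Theta_spec chi_spec factorization
                   q_not_root V_component u Vir) subrK.
  rewrite (S v) (S w) [RHS]addrA [X in _ = X + _]addrA -mulrnDl.
  rewrite wact_wsimple_varpi eqxx [wact w (alpha i) + _]addrC subrK.
  by rewrite addrCA addrA.
under eq_bigr do rewrite uQE.
rewrite big_split /= -QQ.
have -> : \prod_(j | cartan t i j == -1) N (O w j (r - 1)) =
    N (O v i r + O w i (r - 2)).
  rewrite O1 (big_morph N (fun x y => esym (ND x y)) (_ : _ = 1)) //.
  by rewrite /N oppr0.
rewrite !uQE mulrACA ND [X in _ - X]mulrACA ND O2.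
by rewrite -(ND (wact w (alpha i) *+ 2)); ring.
Qed.
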